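(* Let $\mu$ be a translation-invariant, ergodic, finite-energy edge percolation measure on $\mathbb{Z}^2$. Then one of the following holds: \begin{itemize} \item Almost surely $\mu_{\mathrm{hp}}$ has a unique infinite cluster and $\mu^*_{\mathrm{hp}}$ has no infinite cluster. \item Almost surely $\mu^*_{\mathrm{hp}}$ has a unique infinite cluster and $\mu_{\mathrm{hp}}$ has no infinite cluster. \item Almost surely neither $\mu_{\mathrm{hp}}$ nor $\mu^*_{\mathrm{hp}}$ has an infinite cluster. \end{itemize}
   Context: Here $\mathbb{Z}^2$ denotes the square lattice graph: the Cayley graph of the group $\mathbb{Z}^2$ with generators $(1,0),(0,1)$, with edge set $E(\mathbb{Z}^2)$. A (spanning) subgraph corresponds to $\omega\in\{0,1\}^{E(\mathbb{Z}^2)}$, where $\omega_e=1$ means $e$ is open (present) and $\omega_e=0$ means $e$ is closed (absent). An edge percolation measure on $\mathbb{Z}^2$ is a probability measure on $\{0,1\}^{E(\mathbb{Z}^2)}$ (product topology, Borel $\sigma$-algebra). A cluster is a connected component of the subgraph of open edges; it is infinite if it has infinitely many vertices. Statements such as ''almost surely $\mu$ has $k$ infinite clusters'' refer to a random subgraph sampled from $\mu$. The group $\mathbb{Z}^2$ acts on $\{0,1\}^{E(\mathbb{Z}^2)}$ by translations. The measure $\mu$ is translation-invariant if it is invariant under this action, and ergodic if it is ergodic with respect to this action. The measure $\mu$ has finite-energy if there is some $\delta>0$ such that for every $e\in E(\mathbb{Z}^2)$, the conditional probability $\mu(\omega_e=1\mid\omega_{E(\mathbb{Z}^2)\setminus\{e\}})$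 has essential infimum at least $\delta$ and essential supremum at most $1-\delta$. Duality: the planar dual $(\mathbb{Z}^2)^*$ has the plaquettes (unit square faces) of $\mathbb{Z}^2$ as vertices, and each edge $e$ of $\mathbb{Z}^2$ corresponds to a dual edge $e^*$ joining the two plaquettes touching $e$. The dual is identified with $\mathbb{Z}^2$ by identifying the vertex $(x,y)$ with the plaquette centered at $(x+1/2,y+1/2)$. The dual $H^*$ of a subgraph $H$ has $e^*$ open if and only if $e$ is closed in $H$. The dual measure $\mu^*$ is the law of $H^*$ when $H$ is sampled from $\mu$, viewed as an edge percolation measure on $\mathbb{Z}^2$ via this identification. $\mu_{\mathrm{hp}}$ denotes the marginal of $\mu$ on the upper half-plane $\mathbb{Z}\times\mathbb{Z}_{\ge 0}$ (i.e., the law of $\omega$ restricted to edges with both endpoints in $\mathbb{Z}\times\mathbb{Z}_{\geq 0}$), and $\mu^*_{\mathrm{hp}}:=(\mu^* )_{\mathrm{hp}}$. *)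

(* Defs.v *)
From HB Require Import structures.
From Stdlib Require Import Relation_Operators.
From mathcomp Require Import all_boot all_order all_algebra.
From mathcomp Require Import all_classical all_reals all_analysis.
From mathcomp Require Import ess_sup_inf.

Set Implicit Arguments.
Unset Strict Implicit.
Unset Printing Implicit Defensive.

Import Order.TTheory GRing.Theory Num.Theory.
Import numFieldNormedType.Exports.

Local Open Scope classical_set_scope.
Local Open Scope ring_scope.

(* {0,1}^E with the Borel sigma-algebra of the product topology ([bool] is
   discrete). *)
Definition config (E : Type) : Type :=
  g_sigma_algebraType (@open {ptws E -> bool}).

(* A multigraph is given by its endpoint map [ends : E -> V * V]; the order of
   the two endpoints of an edge is irrelevant. *)
Definition open_adj (V E : Type) (ends : E -> V * V) (w : config E) (u v : V)
  : Prop :=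
  exists e : E, w e /\ (ends e = (u, v) \/ ends e = (v, u)).

Definition open_cluster (V E : Type) (ends : E -> V * V) (w : config E) (v : V)
  : set V :=
  [set u | clos_refl_trans V (open_adj ends w) v u].

Definition is_infinite_cluster (V E : Type) (ends : E -> V * V) (w : config E)
  (C : set V) : Prop :=
  (exists v, C = open_cluster ends w v) /\ infinite_set C.

Definition unique_infinite_cluster (V E : Type) (ends : E -> V * V)
  (w : config E) : Prop :=
  exists! C : set V, is_infinite_cluster ends w C.

Definition no_infinite_cluster (V E : Type) (ends : E -> V * V)
  (w : config E) : Prop :=
  ~ exists C : set V, is_infinite_cluster ends w C.

Definition vertex : Type := (int * int)%type.

(* The edge [(v, false)] joins v to v + (1, 0); the edge [(v, true)] joins v to
   v + (0, 1).  Every edge of the square lattice arises exactly once. *)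
Definition edge : Type := (vertex * bool)%type.

Definition edge_ends (e : edge) : vertex * vertex :=
  (e.1, e.1 + (if e.2 then (0, 1) else (1, 0)) : vertex).

Definition restrict_config (E : Type) (P : pred E) (w : config E)
  : config {e : E | P e} := fun e => w (val e).

Arguments restrict_config {E} P w.

Definition translate (v : vertex) (w : config edge) : config edge :=
  fun e => w (e.1 - v, e.2).

Definition translation_invariant (R : realType)
  (mu : probability (config edge) R) : Prop :=
  forall (v : vertex) (A : set (config edge)), measurable A ->
    mu (translate v @^-1` A) = mu A.

Definition ergodic (R : realType) (mu : probability (config edge) R) : Prop :=
  forall A : set (config edge), measurable A ->
    (forall v : vertex, translate v @^-1` A = A) ->
    mu A = 0%E \/ mu A = 1%E.

(* [f] is a version of the conditional probability of [B] given the
   sub-sigma-algebra [G]. *)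
Definition is_cond_prob d (T : measurableType d) (R : realType)
  (mu : probability T R) (G : set (set T)) (B : set T) (f : T -> R) : Prop :=
  [/\ forall Y : set R, measurable Y -> G (f @^-1` Y),
      mu.-integrable setT (EFin \o f) &
      forall A, G A -> (\int[mu]_(x in A) (f x)%:E = mu (A `&` B))%E].

(* The sigma-algebra generated by the states of the edges other than [e]. *)
Definition sigma_off (e : edge) : set (set (config edge)) :=
  g_sigma_algebra_preimage (restrict_config (predC1 e)).

(* Versions of a conditional probability exist and agree almost surely, so the
   choice of [f] is immaterial. *)
Definition finite_energy (R : realType) (mu : probability (config edge) R)
  : Prop :=
  exists2 delta : R, 0 < delta &
    forall e : edge, exists f : config edge -> R,
      [/\ is_cond_prob mu (sigma_off e) [set w | w e] f,
          (delta%:E <= ess_inf mu (EFin \o f))%E &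
          (ess_sup mu (EFin \o f) <= (1 - delta)%:E)%E].

(* The plaquette centred at (x + 1/2, y + 1/2) is identified with (x, y).  The
   horizontal edge based at (x, y) touches the plaquettes (x, y - 1) and (x, y);
   the vertical edge based at (x, y) touches (x - 1, y) and (x, y). *)
Definition dual_edge (e : edge) : edge :=
  if e.2 then (e.1 - (1, 0), false) else (e.1 - (0, 1), true).

Definition primal_edge (f : edge) : edge :=
  if f.2 then (f.1 + (0, 1), false) else (f.1 + (1, 0), true).

Lemma dual_edgeK : cancel dual_edge primal_edge.
Proof. by case=> v []; rewrite /dual_edge /primal_edge /= subrK. Qed.

Lemma primal_edgeK : cancel primal_edge dual_edge.
Proof. by case=> v []; rewrite /dual_edge /primal_edge /= addrK. Qed.

Definition dual_config (w : config edge) : config edge :=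
  fun f => ~~ w (primal_edge f).

Lemma dual_configE (w : config edge) (e : edge) :
  dual_config w (dual_edge e) = ~~ w e.
Proof. by rewrite /dual_config dual_edgeK. Qed.

Lemma measurable_reindex (E F : Type) (s : F -> E) (b : bool -> bool) :
  measurable_fun setT
    ((fun w f => b (w (s f))) : config E -> config F).
Proof.
have coordE (e : E) : continuous (fun w : {ptws E -> bool} => w e).
  move=> w; have /cvg_sup/(_ e)/cvg_image := @cvg_id _ (nbhs w).
  move=> h; apply: cvg_trans (h _) => {h}.
    move=> Q /= [W nbdW <-]; have Fw := @nbhs_filter {ptws E -> bool} w.
    by apply: (@filterS _ (nbhs w) Fw _ _ _ nbdW); exact: preimage_image.
  by apply/seteqP; split=> // c _; exists (fun=> c).
have cs : continuous ((fun w f => b (w (s f))) :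
    {ptws E -> bool} -> {ptws F -> bool}).
  move=> w; have Fw := @nbhs_filter {ptws E -> bool} w.
  apply/cvg_sup => f A [_ [[C oC <-] /= Cw] CA].
  apply: filterS CA _.
  have nC : nbhs (w (s f)) (b @^-1` C).
    by apply: open_nbhs_nbhs; split=> //; exact: discrete_open.
  exact: (coordE (s f) w _ nC).
apply: (@measurability _ _ (config E) (config F)) => //.
move=> _ [A oA <-]; rewrite setTI; apply: (@sub_sigma_algebra _ setT (@open {ptws E -> bool})).
by move/continuousP : cs => /(_ A oA).
Qed.

Definition hp_vertex (v : vertex) : bool := 0 <= v.2.

Definition hp_edge (e : edge) : bool :=
  hp_vertex (edge_ends e).1 && hp_vertex (edge_ends e).2.

Definition hp_edge_ends (e : {e : edge | hp_edge e})
  : {v : vertex | hp_vertex v} * {v : vertex | hp_vertex v} :=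
  (exist _ (edge_ends (val e)).1 (proj1 (andP (valP e))),
   exist _ (edge_ends (val e)).2 (proj2 (andP (valP e)))).

HB.instance Definition _ (E : Type) (P : pred E) :=
  @isMeasurableFun.Build _ _ (config E) (config {e : E | P e})
    (restrict_config P) (measurable_reindex val id).

HB.instance Definition _ :=
  @isMeasurableFun.Build _ _ (config edge) (config edge)
    dual_config (measurable_reindex primal_edge negb).

Definition dual_measure (R : realType) (mu : probability (config edge) R)
  : probability (config edge) R :=
  distribution mu dual_config.

Definition hp_marginal (R : realType) (mu : probability (config edge) R)
  : probability (config {e : edge | hp_edge e}) R :=
  distribution mu (restrict_config hp_edge).

(* Main.v *)
Require Import Defs.
From Stdlib Require Import Relation_Operators Operators_Properties.
From mathcomp Require Import all_boot all_order all_algebra.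
From mathcomp Require Import all_classical all_reals all_analysis.
From mathcomp Require Import ess_sup_inf.
From mathcomp Require Import zify lra.

(** Write H_k for the half-plane of points of height at least k. Everything
    rests on comparing the half-planes H_k: up to translation, the law of the
    configuration in H_k does not depend on k, and an event about H_k is
    invariant under horizontal translations only, so that ergodicity cannot be
    applied to it directly. If however the event for H_k almost surely implies
    the one for H_(k+1), or conversely, then all of them coincide almost surely,
    their union is invariant under all translations, and a zero-one law holds
    ([zero_one]).

    Finite energy is used through one principle: an almost sure property still
    holds almost surely after every finite modification of the configuration
    ([ae_modification]).  Stationarity along a row is used through another one:
    a single site of a row can never be distinguished ([no_distinguished]).
    For instance, if the clusters of H_(k+1) touching row k+1 had no open edge
    just below a contact point, opening one such edge would distinguish it; so
    infinite clusters touching row k+1 give infinite clusters touching row k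
    ([ae_open_below]), and by the zero-one law either all the H_k have infinite
    clusters touching their boundary row, or no H_k has an infinite cluster.

    Planarity enters through a parity argument ([trap_dual], [trap_primal]): a
    path of H_k between two sites of row k confines to a bounded region every
    other cluster, primal or dual, that starts between them.  Hence a cluster with infinitely many
    boundary contacts on one side only has a distinguished extreme contact,
    which is impossible: a cluster either spans, that is has contacts
    arbitrarily far in both directions, or has finitely many contacts.

    Suppose that infinite clusters exist.  Were there almost surely no spanning
    cluster, then there would be infinitely many infinite clusters touching row
    0, each with finitely many contacts, each containing an infinite cluster of
    H_1 that touches row 1 (a child).  By vertical stationarity the clusters of
    H_0 and those of H_1 have the same density, counted by leftmost contacts.
    Mass transport from clusters to chosen children then shows that almost
    surely distinct clusters of H_1 have distinct parents, which the opening of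
    finitely many edges below row 1 contradicts ([ae_spanning]).

    So there is a spanning cluster, and this survives finite modifications.  An
    infinite cluster other than it cannot touch row 0; joining its lowest point
    to row 0 by an isolated vertical segment makes it touch row 0 once, and the
    new spanning cluster would confine it.  This is uniqueness
    ([infinite_clusters_connected]).  Finally a spanning primal cluster confines
    a dual cluster touching the boundary through a closed boundary edge, so the
    primal and dual half-planes cannot both have infinite clusters
    ([spanning_not_dual]).  All hypotheses pass to the dual measure
    ([regular_dual]), which makes the three cases exhaustive. *)

Set Implicit Arguments.
Unset Strict Implicit.
Unset Printing Implicit Defensive.

Import Order.TTheory GRing.Theory Num.Theory.

Local Open Scope classical_set_scope.
Local Open Scope ring_scope.

(** * Measurability of countably defined events *)

Lemma measurable_Pexists d (T : measurableType d) (I : countType)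
  (P : I -> T -> Prop) :
  (forall i, measurable [set t | P i t]) -> measurable [set t | exists i, P i t].
Proof.
move=> mP; have -> : [set t | exists i, P i t] = \bigcup_i [set t | P i t].
  by apply/seteqP; split=> t /= [i]; [exists i|move=> _; exists i].
by apply: countable_bigcupT_measurable.
Qed.

Lemma measurable_Pnot d (T : measurableType d) (P : T -> Prop) :
  measurable [set t | P t] -> measurable [set t | ~ P t].
Proof. by move=> mP; apply: measurableC. Qed.

Lemma measurable_Pforall d (T : measurableType d) (I : countType)
  (P : I -> T -> Prop) :
  (forall i, measurable [set t | P i t]) -> measurable [set t | forall i, P i t].
Proof.
move=> mP; have -> : [set t | forall i, P i t] = ~` [set t | exists i, ~ P i t].
  by apply/seteqP; split=> t /=; [move=> Pt [i]; apply|move/forallNP => Pt i; exact: contrapT].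
by apply/measurableC/measurable_Pexists => i; exact: measurable_Pnot.
Qed.

Lemma measurable_Pand d (T : measurableType d) (P Q : T -> Prop) :
  measurable [set t | P t] -> measurable [set t | Q t] ->
  measurable [set t | P t /\ Q t].
Proof. exact: measurableI. Qed.

Lemma measurable_Por d (T : measurableType d) (P Q : T -> Prop) :
  measurable [set t | P t] -> measurable [set t | Q t] ->
  measurable [set t | P t \/ Q t].
Proof. exact: measurableU. Qed.

Lemma measurable_Pimply d (T : measurableType d) (P Q : T -> Prop) :
  measurable [set t | P t] -> measurable [set t | Q t] ->
  measurable [set t | P t -> Q t].
Proof.
move=> mP mQ; have -> : [set t | P t -> Q t] = [set t | ~ P t \/ Q t].
  by apply/funext => t /=; rewrite implyE.
by apply: measurable_Por => //; exact: measurable_Pnot.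
Qed.

Lemma measurable_Pconst d (T : measurableType d) (P : Prop) :
  measurable [set t : T | P].
Proof.
have [p|np] := pselect P.
  by have -> : [set t : T | P] = setT by apply/seteqP; split.
by have -> : [set t : T | P] = set0 by apply/seteqP; split.
Qed.

Lemma measurable_coord (E : Type) (e : E) : measurable [set w : config E | w e].
Proof.
have mtt : measurable [set w : config unit | w tt].
  apply: (@sub_sigma_algebra _ setT (@open {ptws unit -> bool})).
  have -> : [set w : config unit | w tt] = (@proj unit (fun=> bool) tt) @^-1` [set true].
    by apply/seteqP; split=> w /=.
  have pc : continuous (fun w : {ptws unit -> bool} => w tt).
    exact: (@proj_continuous unit (fun=> bool) tt).
  have := (@continuousP _ _ _).1 pc [set true].
  apply.
  exact: discrete_open.
by have := @measurable_reindex E unit (fun=> e) id measurableT _ mtt; rewrite setTI.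
Qed.

Definition cylinder (E : Type) (l : seq (E * bool)) : set (config E) :=
  [set w | all (fun p => w p.1 == p.2) l].

(** The supersets of the cylinders through [w] form a filter that converges
    coordinatewise, hence pointwise, to [w]; so it contains [U]. *)
Lemma open_cylinder (E : Type) (U : set {ptws E -> bool}) (w : {ptws E -> bool}) :
  open U -> U w -> exists2 l, cylinder l w & cylinder l `<=` U.
Proof.
move=> oU Uw.
pose F : set_system {ptws E -> bool} :=
  [set A | exists2 l : seq (E * bool), cylinder l w & cylinder l `<=` A].
have FF : Filter F.
  split.
  - by exists [::].
  - move=> A B [l lw lA] [m mw mB]; exists (l ++ m).
      by rewrite /cylinder /= all_cat; apply/andP; split.
    by move=> v; rewrite /cylinder /= all_cat => /andP[/lA Av /mB Bv].
  - by move=> A B AB [l lw lA]; exists l => //; exact: subset_trans lA AB.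
have Fw : F --> w.
  apply/cvg_sup => e A [_ [[C oC <-] /= Cw] CA].
  exists [:: (e, w e)]; first by rewrite /cylinder /= eqxx.
  by move=> v; rewrite /cylinder /= andbT => /eqP vw; apply: CA => /=; rewrite /proj vw.
by have := Fw U (open_nbhs_nbhs (conj oU Uw)).
Qed.

(** There are only countably many cylinders, so every open set is a countable
    union of cylinders, that is of finite intersections of coordinate events. *)
Lemma measurable_config d (T : measurableType d) (E : countType)
  (F : T -> config E) :
  (forall e, measurable [set t | F t e]) -> measurable_fun setT F.
Proof.
move=> mF; apply: (@measurability _ _ T (config E) setT F (@open {ptws E -> bool})) => //.
move=> _ [U oU <-]; rewrite setTI.
have -> : F @^-1` U =
  [set t | exists l : seq (E * bool), cylinder l `<=` U /\ cylinder l (F t)].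
  apply/seteqP; split=> t /=; last by case=> l [lU /lU].
  by move=> /(open_cylinder oU)[l lF lU]; exists l.
apply: measurable_Pexists => l; apply: measurable_Pand; first exact: measurable_Pconst.
elim: l => [|[e b] l IH].
  have -> : [set t | cylinder [::] (F t)] = setT by apply/seteqP; split.
  exact: measurableT.
have -> : [set t | cylinder ((e, b) :: l) (F t)] =
   [set t | (if b then is_true (F t e) else ~ F t e) /\ cylinder l (F t)].
  apply/seteqP; split=> t; rewrite /cylinder /=.
    by move=> /andP[/eqP <- ->]; split=> //; case: (F t e).
  by case: b => -[Fe ->]; rewrite andbT; move: Fe; case: (F t e).
apply: measurable_Pand => //; case: b; first exact: mF.
exact/measurable_Pnot/mF.
Qed.

(** * Finite energy and null events *)

Definition insensitive (e : edge) (A : set (config edge)) : Prop :=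
  forall w w', (forall f, f != e -> w' f = w f) -> A w -> A w'.

(** The qualitative content of finite energy.  It is stated on null events, a
    form that passes to the dual measure by exchanging open and closed. *)
Definition tolerant (R : realType) (mu : probability (config edge) R) : Prop :=
  forall (e : edge) (b : bool) (A : set (config edge)),
    measurable A -> insensitive e A ->
    mu (A `&` [set w | w e = b]) = 0%E -> mu A = 0%E.

(** An insensitive event can be read off the other edges: feed the coordinate
    [e] with the state of any other edge. *)
Lemma insensitive_sigma_off (e : edge) (A : set (config edge)) :
  measurable A -> insensitive e A -> sigma_off e A.
Proof.
move=> mA iA.
have [e' ne] : exists e' : edge, predC1 e e'.
  by exists (e.1, ~~ e.2); apply/eqP; case: (e) => v [] [].
pose s (f : edge) : {f : edge | predC1 e f} := insubd (exist _ e' ne) f.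
have sK (w : config edge) f : f != e -> restrict_config (predC1 e) w (s f) = w f.
  by move=> fe; rewrite /restrict_config /s insubdK.
exists ((fun w f => w (s f)) @^-1` A).
  by rewrite -[X in measurable X]setTI; apply: (measurable_reindex s id).
rewrite setTI; apply/seteqP; split=> w /=; apply: iA => f fe; first by rewrite sK.
by rewrite sK.
Qed.

(** Off a null set the conditional probability of [e] being open lies between
    [delta] and [1 - delta]; integrating over an insensitive event [A] bounds
    the probability that [A] holds with [e] open by [delta * mu A] from below
    and by [(1 - delta) * mu A] from above. *)
Lemma finite_energy_tolerant (R : realType) (mu : probability (config edge) R) :
  finite_energy mu -> tolerant mu.
Proof.
move=> [delta d0 fe] e b A mA iA.
have [f [[_ If fE] finf fsup]] := fe e.
have [N [mN N0 bN]] : mu.-negligible (~` [set w | delta <= f w <= 1 - delta]).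
  have : \forall w \ae mu, delta <= f w <= 1 - delta.
    move/ess_infP : finf; move/ess_supP : fsup; apply: filterS2 => w /=.
    by rewrite !lee_fin => -> ->.
  by [].
have fN w : (A `\` N) w -> delta <= f w <= 1 - delta.
  by move=> [_ Nw]; apply: contrapT => h; apply: Nw; apply: bN.
have mAN : measurable (A `\` N) by exact: measurableD.
have muAN : mu (A `\` N) = mu A.
  rewrite measureD //; last by rewrite ltey_eq fin_num_measure.
  by rewrite (@subset_measure0 _ _ _ mu (A `&` N) N) ?sube0 //; exact: measurableI.
have Ie : (\int[mu]_(x in A `\` N) (f x)%:E = mu (A `&` [set w | w e]))%E.
  rewrite -(negligible_integral mN mA _ N0); last first.
    exact: (integrableS measurableT mA (@subsetT _ A) If).
  exact/fE/insensitive_sigma_off.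
have IfAN := measurable_int mu (integrableS measurableT mAN (@subsetT _ _) If).
have [m mE] : exists m, mu A = m%:E.
  by exists (fine (mu A)); rewrite fineK // fin_num_measure.
have m0 : 0 <= m by rewrite -lee_fin -mE measure_ge0.
have lo : (delta%:E * mu A <= mu (A `&` [set w | w e]))%E.
  rewrite -Ie -muAN -integral_cst //; apply: ge0_le_integral => //.
  - by move=> w _; rewrite lee_fin ltW.
  - by move=> w /fN /andP[]; rewrite lee_fin.
have hi : (mu (A `&` [set w | w e]) <= (1 - delta)%:E * mu A)%E.
  rewrite -Ie -muAN -integral_cst //; apply: ge0_le_integral => //.
  - by move=> w /fN /andP[+ _]; rewrite lee_fin => /(le_trans _); apply; exact: ltW.
  - by move=> w /fN /andP[]; rewrite lee_fin.
case: b => h.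
  move: lo; rewrite h mE -EFinM lee_fin => lo; congr EFin.
  by apply/eqP; rewrite eq_le m0 andbT; nra.
have : mu (A `&` [set w | w e]) = mu A.
  have mc : measurable [set w : config edge | w e] := measurable_coord e.
  rewrite -[X in _ = mu X](setUIDK A [set w | w e]).
  rewrite measureU //; [|exact: measurableI|exact: measurableD|].
    rewrite [X in _ = (_ + X)%E](_ : _ = 0%E) ?adde0 // -h; congr (mu _).
    by apply/seteqP; split=> w /= [Aw]; [move/negP/negbTE|move=> ->].
  by rewrite setDE setIACA setICr setI0.
move=> h1; move: hi; rewrite h1 mE -EFinM lee_fin => hi; congr EFin.
by apply/eqP; rewrite eq_le m0 andbT; nra.
Qed.

(** * Stationarity, ergodicity and local modifications *)

Lemma ae_forall d (T : measurableType d) (R : realType)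
  (mu : {measure set T -> \bar R}) (I : countType) (P : I -> T -> Prop) :
  (forall i, \forall t \ae mu, P i t) -> \forall t \ae mu, forall i, P i t.
Proof.
move=> aeP; have : \forall t \ae mu, forall n : nat,
    if unpickle n is Some i then P i t else True.
  apply: ae_foralln => n; case: (unpickle n) => [i|]; first exact: aeP.
  exact: filterE.
by apply: filterS => t Pt i; have := Pt (pickle i); rewrite pickleK.
Qed.

Lemma measurable_ae0 d (T : measurableType d) (R : realType)
  (mu : {measure set T -> \bar R}) (A : set T) :
  measurable A -> (\forall t \ae mu, ~ A t) <-> mu A = 0%E.
Proof.
move=> mA.
have aeE : almost_everywhere mu [set t | ~ A t] = mu.-negligible A.
  by rewrite /almost_everywhere -[X in mu.-negligible (~` X)]/(~` A) setCK.
split=> [aeA|A0]; first by apply: measure_negligible; rewrite -?aeE.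
suff : almost_everywhere mu [set t | ~ A t] by [].
by rewrite aeE; exists A; split.
Qed.

Lemma measure_disjoint_union d (T : measurableType d) (R : realType)
  (mu : {measure set T -> \bar R}) (I : countType) (F G : I -> set T) :
  (forall i, measurable (F i)) -> (forall i, measurable (G i)) ->
  (forall t i j, F i t -> F j t -> i = j) ->
  (forall t i j, G i t -> G j t -> i = j) ->
  (forall i, mu (F i) = mu (G i)) ->
  mu [set t | exists i, F i t] = mu [set t | exists i, G i t].
Proof.
move=> mF mG dF dG FG.
pose u (H : I -> set T) (n : nat) : set T := [set t | exists2 i, pickle i = n & H i t].
have uE (H : I -> set T) n : u H n = set0 \/ exists i, u H n = H i /\ pickle i = n.
  have [[i ni]|Nn] := pselect (exists i : I, pickle i = n); [right|left].
    exists i; split=> //; apply/seteqP; split=> t /=; last by exists i.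
    by move=> [j + Hj]; rewrite -ni => /(pcan_inj pickleK) <-.
  by apply/seteqP; split=> t //= [i ni _]; apply: Nn; exists i.
have uni (H : I -> set T) : [set t | exists i, H i t] = \bigcup_n u H n.
  apply/seteqP; split=> t /= [i]; first by move=> Ht; exists (pickle i) => //; exists i.
  by move=> _ [j _ Ht]; exists j.
have mu_uni (H : I -> set T) : (forall i, measurable (H i)) ->
    (forall t i j, H i t -> H j t -> i = j) ->
    mu [set t | exists i, H i t] = (\sum_(0 <= n <oo) mu (u H n))%E.
  move=> mH dH; have mu_ n : measurable (u H n).
    by case: (uE H n) => [->//|[i [-> _]]].
  rewrite uni measure_semi_bigcup //; last exact: bigcupT_measurable.
  apply/trivIsetP => m n _ _ mn; apply/seteqP; split=> t //= [[i im Hi] [j jn Hj]].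
  by move/eqP: mn; apply; rewrite -im -jn (dH t i j).
rewrite !mu_uni //; apply: eq_eseriesr => n _.
case: (uE F n) => [F0|[i [-> ni]]].
  case: (uE G n) => [->|[i [_ ni]]]; first by rewrite F0.
  suff : u F n = F i /\ u G n = G i by case=> -> ->; exact: FG.
  by split; apply/seteqP; split=> t /=; try (by exists i); case=> j;
    rewrite -ni => /(pcan_inj pickleK) <-.
rewrite FG; congr (mu _); apply/seteqP; split=> t /=; first by exists i.
by case=> j; rewrite -ni => /(pcan_inj pickleK) <-.
Qed.

Lemma int_transfer (P : int -> Prop) :
  (forall k, P k <-> P (k + 1)) -> forall k l, P k -> P l.
Proof.
move=> PS; have up k (n : nat) : P k <-> P (k + n%:Z).
  elim: n => [|n IH]; first by rewrite addr0.
  by rewrite IH PS -addrA -PoszD addn1.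
move=> k l; have [kl|lk] := leP k l.
  by rewrite (up k `|l - k|%N); congr P; lia.
by rewrite (up l `|k - l|%N) (_ : l + _ = k) //; lia.
Qed.

Definition finite_modification (w w' : config edge) : Prop :=
  exists s : seq edge, forall e, e \notin s -> w' e = w e.

Definition update (e : edge) (b : bool) (w : config edge) : config edge :=
  fun f => if f == e then b else w f.

Lemma measurable_update e b : measurable_fun setT (update e b).
Proof.
apply: measurable_config => f; rewrite /update; case: (f == e).
  exact: measurable_Pconst.
exact: measurable_coord.
Qed.

#[local] Instance ae_config_filter (R : realType)
  (mu : probability (config edge) R) : Filter (almost_everywhere mu).
Proof. exact: ae_filter_ringOfSetsType. Qed.

(** The event that [w] falls into a null set [N] once [e] is set to [b] is
    insensitive to [e], and where [w e = b] it is contained in [N]; so it is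
    null.  There are countably many finite sets of edges to modify. *)
Lemma ae_modification (R : realType) (mu : probability (config edge) R)
  (P : config edge -> Prop) :
  tolerant mu -> (\forall w \ae mu, P w) ->
  \forall w \ae mu, forall w', finite_modification w w' -> P w'.
Proof.
move=> tol aeP.
suff : \forall w \ae mu, forall (s : seq edge) w',
    (forall e, e \notin s -> w' e = w e) -> P w'.
  by apply: filterS => w Pw w' [s]; exact: Pw.
apply: ae_forall; elim => [|e s [N [mN N0 bN]]].
  apply: filterS aeP => w Pw w' w'w.
  by rewrite (_ : w' = w) //; apply: funext => e; exact: w'w.
have mM b : measurable (update e b @^-1` N).
  by rewrite -[X in measurable X]setTI; exact: measurable_update.
have null b : mu (update e b @^-1` N) = 0%E.
  apply: (tol e b); first exact: mM.
    move=> w w' ww' /=; rewrite (_ : update e b w' = update e b w) //.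
    by apply: funext => f; rewrite /update; case: eqP => // /eqP /ww'.
  apply: (subset_measure0 _ mN _ N0).
    apply: measurableI; first exact: mM.
    have mc := measurable_coord e; case: b => //.
    rewrite (_ : [set w | _] = ~` [set w : config edge | w e]); first exact: measurableC.
    by apply/seteqP; split=> w /=; [move=> ->|move=> /negP/negbTE].
  move=> w /= [+ wb]; rewrite (_ : update e b w = w) //.
  by apply: funext => f; rewrite /update; case: eqP => // ->.
exists (update e true @^-1` N `|` update e false @^-1` N); split.
- by apply: measurableU; exact: mM.
- exact: (eq_trans (measureU0 (mM _) (mM _) (null _)) (null _)).
move=> w /= Nw; apply: contrapT => Nw'; apply: Nw => w' w'w.
have Nu : ~ N (update e (w' e) w).
  by move=> Nu; apply: Nw'; case: (w' e) Nu => Nu; [left|right].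
apply: contrapT => NP; apply: Nu; apply: bN => /= h; apply: NP; apply: h => f fs.
rewrite /update; case: eqP => [->//|/eqP fe].
by apply: w'w; rewrite inE negb_or fe.
Qed.

Lemma measurable_translate v : measurable_fun setT (translate v).
Proof. exact: (measurable_reindex (fun e : edge => (e.1 - v, e.2)) id). Qed.

(** Infinitely many disjoint events of the same probability are null: a
    stationary process on a row cannot single out one of its sites. *)
Lemma no_distinguished (R : realType) (mu : probability (config edge) R)
  (D : int -> config edge -> Prop) :
  translation_invariant mu ->
  (forall n, measurable [set w | D n w]) ->
  (forall j n w, D n (translate (j, 0) w) <-> D (n - j) w) ->
  (forall w n m, D n w -> D m w -> n = m) ->
  \forall w \ae mu, forall n, ~ D n w.
Proof.
move=> inv mD eqD dD; apply: ae_forall => n.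
apply/measurable_ae0; first exact: mD.
have muD m : mu (D m) = mu (D n).
  rewrite -(inv (m - n, 0) (D m)); last exact: mD.
  congr (mu _); apply/seteqP; split=> w /=; first by move/eqD; rewrite subKr.
  by move=> ?; apply/eqD; rewrite subKr.
have [r rE] : exists r, mu (D n) = r%:E.
  by exists (fine (mu (D n))); rewrite fineK // fin_num_measure //; exact: mD.
have r0 : 0 <= r by rewrite -lee_fin -rE measure_ge0.
have le1 (N : nat) : N%:R * r <= 1.
  rewrite -lee_fin; pose F (i : 'I_N) : set (config edge) := D (i : nat)%:Z.
  have mF (i : 'I_N) : measurable (F i) by exact: mD.
  have mU : measurable (\big[setU/set0]_(i < N) F i) by exact: bigsetU_measurable.
  apply: le_trans (probability_le1 mu mU).
  rewrite measure_bigsetU_ord //.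
    rewrite (eq_bigr (fun=> r%:E)); last by move=> i _; exact: etrans (muD _) rE.
    by rewrite sumEFin sumr_const card_ord mulr_natl.
  move=> i j _ _ [w [/= Fi Fj]]; apply/val_inj/eqP => /=.
  by rewrite -eqz_nat; apply/eqP; exact: dD Fi Fj.
apply: (etrans rE); congr EFin; apply: contrapT => /eqP rn0.
have rgt : 0 < r by rewrite lt_neqAle eq_sym rn0.
have := le1 (Num.bound r^-1); apply/negP; rewrite -ltNge.
by rewrite -ltr_pdivrMr // div1r; apply: archi_boundP; rewrite invr_ge0.
Qed.

Lemma null_diff_sym d (T : measurableType d) (R : realType)
  (mu : probability T R) (A B : set T) :
  measurable A -> measurable B -> mu (A `\` B) = 0%E -> mu A = mu B ->
  mu (B `\` A) = 0%E.
Proof.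
move=> mA mB AB0 AB.
have AE : mu A = mu (A `&` B).
  by apply: (etrans (measureDI mu mA mB)); rewrite [X in (X + _)%E](_ : _ = 0%E) ?add0e.
apply: etrans (measureD mB mA _) _; first by rewrite ltey_eq fin_num_measure.
rewrite [X in (_ - X)%E](_ : _ = mu A); last by rewrite setIC; exact/esym.
rewrite [X in (X - _)%E](_ : _ = mu A); last exact/esym.
by rewrite subee // fin_num_measure.
Qed.

(** All [E k] have the same probability, so almost sure inclusion is almost sure
    equality.  Their union is invariant under every translation, whereas each
    [E k] is invariant under horizontal ones only. *)
Lemma zero_one (R : realType) (mu : probability (config edge) R)
  (E : int -> config edge -> Prop) :
  translation_invariant mu -> ergodic mu ->
  (forall k, measurable [set w | E k w]) ->
  (forall v k w, E k (translate v w) <-> E (k - v.2) w) ->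
  (forall k, \forall w \ae mu, E k w -> E (k + 1) w) ->
  (\forall w \ae mu, forall k, E k w) \/ (\forall w \ae mu, forall k, ~ E k w).
Proof.
move=> inv erg mE eqE mono.
have muE k l : mu (E k) = mu (E l).
  rewrite -(inv (0, k - l) (E k)); last exact: mE.
  congr (mu _); apply/seteqP; split=> w /=; first by move/eqE; rewrite subKr.
  by move=> ?; apply/eqE; rewrite subKr.
have stepE : \forall w \ae mu, forall k, E k w <-> E (k + 1) w.
  apply: ae_forall => k.
  suff : \forall w \ae mu, ~ (E (k + 1) `\` E k) w.
    apply: filterS2 (mono k) => w up h; split=> // E1.
    by apply: contrapT => NE; apply: h; split.
  have mk : measurable (E k) := mE k; have m1 : measurable (E (k + 1)) := mE (k + 1).
  have null : mu (E k `\` E (k + 1)) = 0%E.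
    apply/measurable_ae0; first exact: measurableD.
    by apply: filterS (mono k) => w up [/up].
  apply/measurable_ae0; first exact: measurableD.
  exact: (null_diff_sym mk m1 null (muE k (k + 1))).
pose U : set (config edge) := [set w | exists k, E k w].
have mU : measurable U by exact: measurable_Pexists.
have invU v : translate v @^-1` U = U.
  apply/seteqP; split=> w /= [k]; first by move/eqE; exists (k - v.2).
  by move=> Ek; exists (k + v.2); apply/eqE; rewrite addrK.
case: (erg U mU invU) => [/(measurable_ae0 mu mU).2 h|U1]; [right|left].
  by apply: filterS h => w NU k Ek; apply: NU; exists k.
have : mu (~` U) = 0%E by rewrite probability_setC // U1 subee.
move=> /(measurable_ae0 mu (measurableC mU)).2; apply: filterS2 stepE => w wE.
by move/contrapT => [k Ek] l; exact: (@int_transfer (fun k => E k w) wE k l Ek).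
Qed.

(** If [G m n] says that [m] sends a unit of mass to [n], the expected mass sent
    by 0 is the expected mass received by 0: the terms match through
    [mu (G 0 n) = mu (G (- n) 0)]. *)
Lemma mass_transport (R : realType) (mu : probability (config edge) R)
  (G : int -> int -> config edge -> Prop) :
  translation_invariant mu ->
  (forall m n, measurable [set w | G m n w]) ->
  (forall j m n w, G m n (translate (j, 0) w) <-> G (m - j) (n - j) w) ->
  (forall w m n n', G m n w -> G m n' w -> n = n') ->
  (forall w m m' n, G m n w -> G m' n w -> m = m') ->
  mu [set w | exists n, G 0 n w] = mu [set w | exists m, G m 0 w].
Proof.
move=> inv mG eqG dG dG'.
have -> : [set w | exists m, G m 0 w] = [set w | exists n, G (- n) 0 w].
  by apply/seteqP; split=> w /= [m Gm]; [exists (- m); rewrite opprK|exists (- m)].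
apply: (@measure_disjoint_union _ _ _ mu int (G 0) (fun n => G (- n) 0)).
- by move=> n; exact: mG.
- by move=> n; exact: mG.
- by move=> w m n; exact: dG.
- by move=> w m n h /(dG' _ _ _ _ h)/oppr_inj.
move=> n; apply: etrans (esym (inv (n, 0) (G 0 n) (mG 0 n))) _.
congr (mu _); apply/seteqP; split=> w /=; first by move/eqG; rewrite sub0r subrr.
by move=> ?; apply/eqG; rewrite sub0r subrr.
Qed.

Lemma ae_exists (R : realType) (mu : probability (config edge) R)
  (P : config edge -> Prop) : (\forall w \ae mu, P w) -> exists w, P w.
Proof.
move=> [N [mN N0 PN]]; apply: contrapT => /forallNP nP.
have : mu setT = 0%E.
  by apply: (subset_measure0 measurableT mN) => // w _; exact/PN/nP.
by rewrite probability_setT => /eqP; rewrite onee_eq0.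
Qed.

(** The hypotheses on the measure, in a form stable under duality. *)
Record regular (R : realType) (mu : probability (config edge) R) : Prop := Regular {
  regular_invariant : translation_invariant mu;
  regular_ergodic : ergodic mu;
  regular_tolerant : tolerant mu }.

(** * Clusters of half-planes *)

Section HalfPlanes.

Implicit Types (w : config edge) (k l x y n m : int) (u v z : vertex).

(** Adjacency inside the half-plane of height at least [k]: the base point of an
    edge is its lowest endpoint, so testing its height suffices. *)
Definition hadj (k : int) (w : config edge) (u v : vertex) : Prop :=
  exists e : edge, [/\ k <= e.1.2, w e &
    edge_ends e = (u, v) \/ edge_ends e = (v, u)].

Definition hconn (k : int) (w : config edge) (u v : vertex) : Prop :=
  clos_refl_trans vertex (hadj k w) u v.

Definition hinf (k : int) (w : config edge) (u : vertex) : Prop :=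
  infinite_set [set v | hconn k w u v].

Lemma hconn_refl k w u : hconn k w u u. Proof. exact: rt_refl. Qed.

Lemma hconn_trans k w u v z : hconn k w u v -> hconn k w v z -> hconn k w u z.
Proof. exact: rt_trans. Qed.

Lemma hconn_sym k w u v : hconn k w u v -> hconn k w v u.
Proof.
elim=> [x y [e [ke we E]]|x|x y z _ yx _ zy]; last exact: hconn_trans zy yx.
  by apply: rt_step; exists e; split=> //; tauto.
exact: hconn_refl.
Qed.

Lemma hconn_edge k w (e : edge) : k <= e.1.2 -> w e -> hconn k w e.1 (edge_ends e).2.
Proof. by move=> ke we; apply: rt_step; exists e; split=> //; left. Qed.

(** Edges are not oriented, so the property has to be transported along each open
    edge in both directions. *)
Lemma hadj_ind k w (P : vertex -> Prop) :
  (forall e : edge, k <= e.1.2 -> w e -> P e.1 <-> P (edge_ends e).2) ->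
  forall u v, hconn k w u v -> P u -> P v.
Proof.
move=> step u v; elim=> [x y [e [ke we E]]|//|x y z _ xy _ yz /xy/yz //].
by case: E => -[E1 E2]; have [] := step e ke we; rewrite [(edge_ends e).2]E2 [e.1]E1.
Qed.

Lemma hconn_mono k l w w' u v : l <= k ->
  (forall e : edge, k <= e.1.2 -> w e -> w' e) -> hconn k w u v -> hconn l w' u v.
Proof.
move=> lk ww' uv; apply: (hadj_ind (P := hconn l w' u) _ uv); last exact: hconn_refl.
move=> e ke we; have E := hconn_edge (le_trans lk ke) (ww' e ke we).
by split=> h; apply: (hconn_trans h) => //; exact: hconn_sym.
Qed.

Lemma edge_endsE (e : edge) : edge_ends e =
  (e.1, (e.1.1 + (~~ e.2)%:Z, e.1.2 + e.2%:Z)).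
Proof. by case: e => [[a b] []]. Qed.

Lemma hconn_ge k w u v : hconn k w u v -> k <= u.2 -> k <= v.2.
Proof.
move=> uv; apply: (hadj_ind (P := fun v => k <= v.2) _ uv) => e ke _.
by rewrite edge_endsE /=; case: e ke => [[a b] []] /=; lia.
Qed.

Lemma hconn_below k w u v : hconn k w u v -> u.2 < k -> v = u.
Proof.
move=> uv uk; apply: (hadj_ind (P := eq^~ u) _ uv) => // e ke we; split=> E.
  by move: ke; rewrite E leNgt uk.
move: E; rewrite edge_endsE /= => E; move: uk; rewrite -E /=.
by case: e ke {we E} => [[a b] []] /=; lia.
Qed.

Lemma hinf_conn k w u v : hconn k w u v -> hinf k w u -> hinf k w v.
Proof.
move=> uv; apply: contra_not; apply: sub_finite_set => z /=.
by apply: hconn_trans; exact: hconn_sym.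
Qed.

Lemma hinf_mono k l w w' u : l <= k ->
  (forall e : edge, k <= e.1.2 -> w e -> w' e) -> hinf k w u -> hinf l w' u.
Proof.
by move=> lk ww'; apply: contra_not; apply: sub_finite_set => v; exact: hconn_mono.
Qed.

Lemma hinf_ge k w u : hinf k w u -> k <= u.2.
Proof.
move=> iu; rewrite leNgt; apply/negP => uk; apply: iu.
apply: (@sub_finite_set _ _ [set u]); last exact: finite_set1.
by move=> v uv; exact: hconn_below uv uk.
Qed.

Definition vnorm (v : vertex) : nat := (`|v.1| + `|v.2|)%N.

Lemma finite_int_ball (N : nat) : finite_set [set x : int | (`|x| <= N)%N].
Proof.
apply: (@sub_finite_set _ _ ((fun i : nat => i%:Z - N%:Z) @` `I_(N.*2.+1))).
  by move=> x /= xN; exists `|(x + N%:Z)%R|%N; lia.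
exact/finite_image/finite_II.
Qed.

Lemma finite_ball (N : nat) : finite_set [set v | (vnorm v <= N)%N].
Proof.
apply: (sub_finite_set _ (finite_setX (finite_int_ball N) (finite_int_ball N))).
by move=> v; rewrite /vnorm /=; lia.
Qed.

Lemma finite_vnorm (A : set vertex) :
  finite_set A -> exists N, forall v, A v -> (vnorm v <= N)%N.
Proof.
move=> /finite_seqP[s ->]; elim: s => [|u s [N sN]]; first by exists 0%N.
exists (maxn (vnorm u) N) => v; rewrite /= inE => /orP[/eqP ->|/sN]; lia.
Qed.

Lemma hinfP k w u :
  hinf k w u <-> forall N : nat, exists v, hconn k w u v /\ (N < vnorm v)%N.
Proof.
split=> [iu N|big fin].
  apply: contrapT => /forallNP h; apply: iu; apply: sub_finite_set (finite_ball N) => v /= uv.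
  by rewrite leqNgt; apply/negP => Nv; exact: (h v).
have [N fN] := finite_vnorm fin; have [v [uv]] := big N.
by rewrite ltnNge => /negP; apply; exact: fN.
Qed.

Lemma vertexBE (u v : vertex) : u - v = (u.1 - v.1, u.2 - v.2).
Proof. by case: u v => [? ?] [? ?]. Qed.

Lemma vertexDE (u v : vertex) : u + v = (u.1 + v.1, u.2 + v.2).
Proof. by case: u v => [? ?] [? ?]. Qed.

Lemma hadj_translate k t w u v :
  hadj k (translate t w) u v <-> hadj (k - t.2) w (u - t) (v - t).
Proof.
rewrite /hadj /translate !vertexBE; case: t u v => [t1 t2] [u1 u2] [v1 v2] /=.
split.
  move=> [[[a b] d] [/= kb]]; rewrite vertexBE /= => we E.
  exists ((a - t1, b - t2), d); split=> //=; first by rewrite lerB.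
  move: E; rewrite !edge_endsE /= => -[[<- <- <- <-]|[<- <- <- <-]];
    by [left; congr (_, (_, _)); lia | right; congr (_, (_, _)); lia].
move=> [[[a b] d] [/= kb we E]]; exists ((a + t1, b + t2), d); split=> /=.
- by move: kb; lia.
- by rewrite vertexBE /= !addrK.
move: E; rewrite !edge_endsE /= => -[[-> -> E1 E2]|[-> -> E1 E2]].
  by left; rewrite !subrK; congr (_, (_, _)); lia.
by right; rewrite !subrK; congr (_, (_, _)); lia.
Qed.

Lemma hconn_translate k t w u v :
  hconn k (translate t w) u v <-> hconn (k - t.2) w (u - t) (v - t).
Proof.
split=> [|h].
  elim=> [x y /hadj_translate|x|x y z _ + _]; first exact: rt_step.
    exact: hconn_refl.
  exact: hconn_trans.
have : hconn k (translate t w) (u - t + t) (v - t + t).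
  elim: h => [x y xy|x|x y z _ + _]; last exact: hconn_trans.
    by apply: rt_step; apply/hadj_translate; rewrite !addrK.
  exact: hconn_refl.
by rewrite !subrK.
Qed.

Lemma hinf_translate k t w u :
  hinf k (translate t w) u <-> hinf (k - t.2) w (u - t).
Proof.
split; apply: contra_not => fin.
  have := finite_image (fun v => v + t) fin; apply: sub_finite_set.
  by move=> v /= /hconn_translate h; exists (v - t); rewrite ?subrK.
have := finite_image (fun v => v - t) fin; apply: sub_finite_set.
by move=> v /= h; exists (v + t); rewrite ?addrK //=; apply/hconn_translate; rewrite addrK.
Qed.

Lemma measurable_hconn k u v : measurable [set w | hconn k w u v].
Proof.
pose reach := fix reach (i : nat) u v w := if i is i'.+1 then
  exists z, hadj k w u z /\ reach i' z v w else u = v.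
have -> : [set w | hconn k w u v] = [set w | exists i, reach i u v w].
  apply/seteqP; split=> w /=.
    move=> uv; have {uv} := clos_rt_rt1n _ _ _ _ uv.
    elim=> [x|x y z xy _ [i IH]]; first by exists 0%N.
    by exists i.+1, y.
  case=> i; elim: i u => [u ->|i IH u [z [uz /IH zv]]]; first exact: hconn_refl.
  by apply: hconn_trans zv; exact: rt_step.
apply: measurable_Pexists => i; elim: i u => [u|i IH u].
  exact: measurable_Pconst.
rewrite /=; apply: measurable_Pexists => z; apply: measurable_Pand; last exact: IH.
apply: measurable_Pexists => e.
have -> : [set w : config edge | [/\ k <= e.1.2, w e &
    edge_ends e = (u, z) \/ edge_ends e = (z, u)]] = [set w : config edge |
    w e /\ (k <= e.1.2 /\ (edge_ends e = (u, z) \/ edge_ends e = (z, u)))].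
  by apply/seteqP; split=> w /= [] => [ke we E|we [ke E]]; split.
apply: measurable_Pand; [exact: measurable_coord|exact: measurable_Pconst].
Qed.

Lemma measurable_hinf k u : measurable [set w | hinf k w u].
Proof.
rewrite (_ : [set w | _] = [set w | forall N : nat, exists v,
    hconn k w u v /\ (N < vnorm v)%N]); last first.
  by apply/funext => w /=; apply/propext; exact: hinfP.
apply: measurable_Pforall => N; apply: measurable_Pexists => v.
by apply: measurable_Pand; [exact: measurable_hconn|exact: measurable_Pconst].
Qed.

(** * Planarity *)

Definition above x y v : bool := (v.1 == x) && (y < v.2).

(** For a walk from [u] to [v] in the half-plane, [c x y] stands for the parity
    of the number of horizontal steps of the walk that cross the vertical ray
    going up from the centre of the plaquette [(x, y)].  Only the edge between
    two neighbouring plaquettes can separate their rays, up to the following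
    correction when moving to the right: the steps counted by exactly one of the
    two rays enter or leave the half-column [above (x + 1) y], and there is an
    odd number of them when exactly one of [u] and [v] lies in it.  The ray of a
    plaquette of the bottom row meets all the crossings of its column but those
    through the edge just below it, so that its parity tells whether [u] and [v]
    lie on different sides. *)
Record crossing_parity k w u v (c : int -> int -> bool) : Prop := CrossingParity {
  parity_up : forall x y, k <= y -> ~~ w ((x, y + 1), false) -> c x y = c x (y + 1);
  parity_right : forall x y, k <= y -> ~~ w ((x + 1, y), true) ->
    c x y (+) c (x + 1) y = above (x + 1) y u (+) above (x + 1) y v;
  parity_bottom : forall x, ~~ w ((x, k), false) ->
    c x k = (u.1 <= x) (+) (v.1 <= x);
  parity_far : exists N : nat, forall x y, k <= y -> (N < vnorm (x, y))%N -> c x y = false }.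

Lemma crossing_parity_edge k w (e : edge) : k <= e.1.2 -> w e ->
  crossing_parity k w e.1 (edge_ends e).2
    (fun x y => [&& ~~ e.2, e.1.1 == x & y < e.1.2]).
Proof.
rewrite edge_endsE; case: e => [[a b] d] /= kb we; split=> /=.
- move=> x y ky; case: d we => //= we nw.
  have : ~~ ((a == x) && (b == y + 1)).
    by apply: contra nw => /andP[/eqP <- /eqP <-].
  by lia.
- move=> x y ky; rewrite /above; case: d we => //= we nw.
    have : ~~ ((a == x + 1) && (b == y)).
      by apply: contra nw => /andP[/eqP <- /eqP <-].
    by lia.
  by rewrite addr0 (inj_eq (addIr 1)) addbC.
- move=> x; case: d we => //= we nw; first by rewrite addr0 addbb.
  have : ~~ ((a == x) && (b == k)).
    by apply: contra nw => /andP[/eqP <- /eqP <-].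
  by lia.
exists (`|a| + `|b| + `|k|)%N => x y ky; rewrite /vnorm /= => big.
by apply/negbTE; rewrite !negb_and; lia.
Qed.

Lemma crossing_parity_sym k w u v c :
  crossing_parity k w u v c -> crossing_parity k w v u c.
Proof.
case=> up right bottom far; split=> // *; first by rewrite right // addbC.
by rewrite bottom // addbC.
Qed.

(** Parities of concatenated walks add up, so the walk itself need not be
    recorded: single edges suffice. *)
Lemma crossing_parity_exists k w u v :
  hconn k w u v -> exists c, crossing_parity k w u v c.
Proof.
elim=> [x y [e [ke we E]]|x|x y z _ [c C] _ [d D]].
- have := crossing_parity_edge ke we; set c := (X in crossing_parity _ _ _ _ X) => C.
  exists c; case: E => E.
    by rewrite -[x](congr1 fst E : e.1 = x) -[y](congr1 snd E : (edge_ends e).2 = y).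
  apply: crossing_parity_sym.
  by rewrite -[y](congr1 fst E : e.1 = y) -[x](congr1 snd E : (edge_ends e).2 = x).
- exists (fun _ _ => false); split=> //; [by move=> *; rewrite !addbb..|].
  by exists 0%N.
exists (fun x y => c x y (+) d x y); split.
- by move=> a b kb nw; rewrite (parity_up C) // (parity_up D).
- move=> a b kb nw /=; rewrite addbACA (parity_right C) // (parity_right D) //.
  by rewrite addbA -(addbA (above _ _ x)) addbb addbF.
- move=> a nw; rewrite (parity_bottom C) // (parity_bottom D) //.
  by rewrite addbA -(addbA (x.1 <= a)) addbb addbF.
case: (parity_far C) (parity_far D) => [M cM] [N dN]; exists (maxn M N) => a b kb.
by rewrite gtn_max => /andP[/(cM _ _ kb) -> /(dN _ _ kb) ->].
Qed.

(** The plaquette [(x, k)] has odd parity with respect to a walk from [(a1, k)]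
    to [(a2, k)]: the walk crosses its column, and not through the edge just
    below it, which is closed.  Dual connections preserve the parity, as both
    endpoints of the walk are on the boundary, and far plaquettes are even. *)
Lemma trap_dual k w a1 a2 x : hconn k w (a1, k) (a2, k) -> a1 <= x -> x < a2 ->
  ~~ w ((x, k), false) -> ~ hinf k (dual_config w) (x, k).
Proof.
move=> /crossing_parity_exists[c [up right bottom [N far]]] ax xa nw.
have notabove (y b a : int) : k <= y -> above b y (a, k) = false.
  by rewrite /above /= => ky; apply/negbTE; rewrite negb_and; lia.
have cx : c x k by rewrite bottom //= ax leNgt xa.
have inside v : hconn k (dual_config w) (x, k) v -> k <= v.2 /\ c v.1 v.2.
  move=> xv; apply: (hadj_ind (P := fun v => k <= v.2 /\ c v.1 v.2) _ xv); last by split.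
  move=> e; rewrite edge_endsE; case: e => [[a b] d] /= kb.
  rewrite /dual_config /primal_edge; case: d => /= nwe.
    rewrite vertexDE /= addr0 in nwe.
    rewrite addr0 (up a b) //; split=> -[_ ->]; split=> //; lia.
  rewrite vertexDE /= addr0 in nwe.
  have := right a b kb nwe; rewrite !notabove // addbb addr0.
  by case: (c a b) (c (a + 1) b) => [] [].
move/hinfP => /(_ N) [[a b] [/inside /= [kb cab] Nab]].
by rewrite far in cab.
Qed.

(** Reduced to the dual statement by viewing the vertex [(x, y)] as the plaquette
    [(x, y)].  The dual edge crosses the edge based at the further endpoint of
    the primal one, and no edge based at a vertex outside the cluster of
    [(a1, k)] is used by a walk in that cluster. *)
Lemma trap_primal k w a1 a2 x : hconn k w (a1, k) (a2, k) -> a1 < x -> x < a2 ->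
  ~ hconn k w (a1, k) (x, k) -> ~ hinf k w (x, k).
Proof.
move=> a12 ax xa nax.
(* wC keeps the open edges based in the cluster of (a1, k) *)
pose wC : config edge := fun e => w e && `[< hconn k w (a1, k) e.1 >].
have inC v : hconn k w (a1, k) v -> hconn k wC (a1, k) v.
  move=> av; suff [] : hconn k w (a1, k) v /\ hconn k wC (a1, k) v by [].
  apply: (hadj_ind (P := fun v => _ /\ hconn k wC (a1, k) v) _ av); last first.
    by split; exact: hconn_refl.
  move=> e ke we; have E := hconn_edge ke we; split=> -[h hC].
    have E' : hconn k wC e.1 (edge_ends e).2.
      by apply: hconn_edge => //; rewrite /wC we; apply/asboolP.
    by split; [exact: hconn_trans h E|exact: hconn_trans hC E'].
  have h1 := hconn_trans h (hconn_sym E).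
  have E' : hconn k wC e.1 (edge_ends e).2.
    by apply: hconn_edge => //; rewrite /wC we; apply/asboolP.
  by split=> //; exact: hconn_trans hC (hconn_sym E').
have nC v : ~ hconn k w (a1, k) v -> ~~ wC (v, false) /\ ~~ wC (v, true).
  by move=> nv; split; apply/negP => /andP[_ /asboolP].
apply: contra_not (@trap_dual k wC a1 a2 x (inC _ a12) (ltW ax) xa (nC _ nax).1).
apply: contra_not; apply: sub_finite_set => v /= xv.
suff [] : ~ hconn k w (a1, k) v /\ hconn k (dual_config wC) (x, k) v by [].
apply: (hadj_ind (P := fun v => _ /\ hconn k (dual_config wC) (x, k) v) _ xv); last first.
  by split=> //; exact: hconn_refl.
move=> e ke we; have E := hconn_edge ke we.
have E' : ~ hconn k w (a1, k) (edge_ends e).2 ->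
    hconn k (dual_config wC) e.1 (edge_ends e).2.
  move=> /nC[nf nt]; apply: hconn_edge => //; rewrite /dual_config.
  by case: e ke we E nf nt => u [] /=.
have CE : hconn k w (a1, k) (edge_ends e).2 <-> hconn k w (a1, k) e.1.
  by split=> h; apply: hconn_trans h _ => //; exact: hconn_sym.
rewrite CE in E' *; split=> -[h hx]; split=> //.
  by apply: hconn_trans hx (E' h).
by apply: hconn_trans hx (hconn_sym (E' h)).
Qed.

(** * Clusters that touch the boundary row *)

Lemma int_min (P : int -> Prop) (b : int) :
  (forall x, P x -> b <= x) -> (exists x, P x) ->
  exists2 m, P m & forall x, P x -> m <= x.
Proof.
move=> Pb [x0 Px0].
have ex : exists i : nat, `[< P (b + i%:Z) >].
  exists `|x0 - b|%N; apply/asboolP; rewrite (_ : _ + _ = x0) //.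
  by have := Pb _ Px0; lia.
case: (ex_minnP ex) => i /asboolP Pi mini; exists (b + i%:Z) => // x Px.
have bx := Pb _ Px.
have := mini `|x - b|%N; rewrite (_ : b + _ = x); last by lia.
by move=> /(_ (asboolT Px)); lia.
Qed.

Lemma int_max (P : int -> Prop) (b : int) :
  (forall x, P x -> x <= b) -> (exists x, P x) ->
  exists2 m, P m & forall x, P x -> x <= m.
Proof.
move=> Pb [x0 Px0]; have [] := @int_min (fun x => P (- x)) (- b).
- by move=> x /Pb; rewrite lerNl.
- by exists (- x0); rewrite opprK.
by move=> m Pm min; exists (- m) => // x Px; rewrite lerNr; apply: min; rewrite opprK.
Qed.

Lemma hconn_row_shift k l l' j n m w :
  hconn k (translate (j, 0) w) (n, l) (m, l') <-> hconn k w (n - j, l) (m - j, l').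
Proof. by rewrite hconn_translate !vertexBE /= !subr0. Qed.

Lemma hinf_row_shift k l j n w :
  hinf k (translate (j, 0) w) (n, l) <-> hinf k w (n - j, l).
Proof. by rewrite hinf_translate !vertexBE /= !subr0. Qed.

Definition touching k w : Prop := exists n, hinf k w (n, k).

Lemma touching_translate v k w : touching k (translate v w) <-> touching (k - v.2) w.
Proof.
split=> [[n]|[n h]]; first by move/hinf_translate; rewrite vertexBE; exists (n - v.1).
by exists (n + v.1); apply/hinf_translate; rewrite vertexBE /= addrK.
Qed.

Lemma measurable_touching k : measurable [set w | touching k w].
Proof. by apply: measurable_Pexists => n; exact: measurable_hinf. Qed.

(** Otherwise open one edge below a contact of an infinite cluster of the
    half-plane above: it becomes the only such edge that is open, and so its
    site is distinguished. *)
Lemma ae_open_below (R : realType) (mu : probability (config edge) R)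
  (reg : regular mu) k :
  \forall w \ae mu, touching (k + 1) w ->
  exists2 n, hinf (k + 1) w (n, k + 1) & w ((n, k), true).
Proof.
pose D n w := hinf (k + 1) w (n, k + 1) /\ w ((n, k), true) /\
  forall m, m <> n -> hinf (k + 1) w (m, k + 1) -> ~ w ((m, k), true).
have noD : \forall w \ae mu, forall n, ~ D n w.
  apply: (no_distinguished (regular_invariant reg)).
  - move=> n; apply: measurable_Pand; first exact: measurable_hinf.
    apply: measurable_Pand; first exact: measurable_coord.
    apply: measurable_Pforall => m; apply: measurable_Pimply; first exact: measurable_Pconst.
    apply: measurable_Pimply; first exact: measurable_hinf.
    by apply: measurable_Pnot; exact: measurable_coord.
  - move=> j n w; rewrite /D hinf_row_shift /translate /= vertexBE /= subr0.
    split=> -[h1 [h2 h3]]; split=> //; split=> // m mn.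
      have := h3 (m + j); rewrite hinf_row_shift vertexBE /= subr0 addrK; apply.
      by move=> E; apply: mn; rewrite -E addrK.
    rewrite hinf_row_shift vertexBE /= subr0; apply: h3.
    by move=> /(congr1 (+%R^~ j)); rewrite !subrK.
  - move=> w n m [h1 [h2 _]] [_ [_ /(_ n) h3]].
    by apply: contrapT => nm; exact: h3.
apply: filterS (ae_modification (regular_tolerant reg) noD) => w fd [n hn].
apply: contrapT => no.
pose w' := update ((n, k), true) true w.
have w'E e : k + 1 <= e.1.2 -> w' e = w e.
  by rewrite /w' /update; case: eqP => // -> /=; lia.
have hE m : hinf (k + 1) w' (m, k + 1) -> hinf (k + 1) w (m, k + 1).
  by apply: hinf_mono => // e ke; rewrite w'E.
apply: (fd w' _ n).
  exists [:: ((n, k), true)] => e; rewrite inE => en.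
  by rewrite /w' /update (negbTE en).
split; first by apply: hinf_mono hn => // e ke; rewrite w'E.
split; first by rewrite /w' /update eqxx.
move=> m mn /hE hm; rewrite /w' /update.
case: eqP => [[E]|_ wm]; first by case: mn.
by apply: no; exists m.
Qed.

(** Through an open edge below, an infinite cluster touching row [k + 1] makes an
    infinite cluster touch row [k]. *)
Lemma touching_zero_one (R : realType) (mu : probability (config edge) R)
  (reg : regular mu) :
  (\forall w \ae mu, forall k, touching k w) \/
  (\forall w \ae mu, forall k, ~ touching k w).
Proof.
have [||k|h|h] := @zero_one R mu (fun k w => ~ touching k w)
  (regular_invariant reg) (regular_ergodic reg).
- by move=> k; apply: measurable_Pnot; exact: measurable_touching.
- by move=> v k w; rewrite touching_translate.
- apply: filterS (ae_open_below reg k) => w ob nt /ob[n hn wn]; apply: nt; exists n.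
  have : hconn k w (n, k + 1) (n, k).
    apply: hconn_sym; have := @hconn_edge k w ((n, k), true).
    by rewrite edge_endsE /= addr0; apply.
  move=> /hinf_conn; apply; apply: hinf_mono hn => //; lia.
- by right.
by left; apply: filterS h => w h k; exact: contrapT.
Qed.

(** The last contact of infinite clusters would be a distinguished site. *)
Lemma ae_touching_right (R : realType) (mu : probability (config edge) R)
  (reg : regular mu) k :
  \forall w \ae mu, touching k w ->
  forall m, exists2 n, m < n & hinf k w (n, k).
Proof.
pose D n w := hinf k w (n, k) /\ forall m, n < m -> ~ hinf k w (m, k).
have : \forall w \ae mu, forall n, ~ D n w.
  apply: (no_distinguished (regular_invariant reg)).
  - move=> n; apply: measurable_Pand; first exact: measurable_hinf.
    apply: measurable_Pforall => m; apply: measurable_Pimply; first exact: measurable_Pconst.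
    by apply: measurable_Pnot; exact: measurable_hinf.
  - move=> j n w; rewrite /D hinf_row_shift; split=> -[h1 h2]; split=> // m nm.
      by have := h2 (m + j); rewrite hinf_row_shift addrK; apply; lia.
    by rewrite hinf_row_shift; apply: h2; lia.
  - move=> w n m [hn nm] [hm mn]; case: (ltgtP n m) => // lt.
      by case: (nm _ lt).
    by case: (mn _ lt).
apply: filterS => w noD tk m; apply: contrapT => no.
have bound x : hinf k w (x, k) -> x <= m.
  by move=> hx; rewrite leNgt; apply/negP => mx; apply: no; exists x.
have [n hn nmax] := int_max bound tk.
by apply: (noD n); split=> // x nx /nmax; lia.
Qed.

Definition right_unbounded k w n : Prop :=
  forall m, exists2 j, m < j & hconn k w (n, k) (j, k).

Definition left_unbounded k w n : Prop :=
  forall m, exists2 j, j < m & hconn k w (n, k) (j, k).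

Definition bounded_contacts k w n : Prop :=
  exists N : nat, forall j, hconn k w (n, k) (j, k) -> (`|j| <= N)%N.

Definition spanning k w : Prop :=
  exists2 n, left_unbounded k w n & right_unbounded k w n.

Lemma right_unbounded_hinf k w n : right_unbounded k w n -> hinf k w (n, k).
Proof.
move=> rn; apply/hinfP => N; have [j Nj nj] := rn N.
by exists (j, k); split=> //; rewrite /vnorm /=; lia.
Qed.

Lemma left_unbounded_hinf k w n : left_unbounded k w n -> hinf k w (n, k).
Proof.
move=> ln; apply/hinfP => N; have [j Nj nj] := ln (- N%:Z).
by exists (j, k); split=> //; rewrite /vnorm /=; lia.
Qed.

Lemma measurable_right_unbounded k n : measurable [set w | right_unbounded k w n].
Proof.
rewrite (_ : [set w | _] = [set w | forall m, exists j, m < j /\ hconn k w (n, k) (j, k)]).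
  apply: measurable_Pforall => m; apply: measurable_Pexists => j.
  by apply: measurable_Pand; [exact: measurable_Pconst|exact: measurable_hconn].
by apply/seteqP; split=> w h m; have [j] := h m; [exists j|case=> ? ?; exists j].
Qed.

Lemma measurable_left_unbounded k n : measurable [set w | left_unbounded k w n].
Proof.
rewrite (_ : [set w | _] = [set w | forall m, exists j, j < m /\ hconn k w (n, k) (j, k)]).
  apply: measurable_Pforall => m; apply: measurable_Pexists => j.
  by apply: measurable_Pand; [exact: measurable_Pconst|exact: measurable_hconn].
by apply/seteqP; split=> w h m; have [j] := h m; [exists j|case=> ? ?; exists j].
Qed.

Lemma right_unbounded_translate t k w n :
  right_unbounded k (translate t w) n <-> right_unbounded (k - t.2) w (n - t.1).
Proof.
split=> h m.
  have [j mj /hconn_translate] := h (m + t.1); rewrite !vertexBE /=.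
  by exists (j - t.1) => //; lia.
have [j mj nj] := h (m - t.1); exists (j + t.1); first lia.
by apply/hconn_translate; rewrite !vertexBE /= addrK.
Qed.

Lemma left_unbounded_translate t k w n :
  left_unbounded k (translate t w) n <-> left_unbounded (k - t.2) w (n - t.1).
Proof.
split=> h m.
  have [j mj /hconn_translate] := h (m + t.1); rewrite !vertexBE /=.
  by exists (j - t.1) => //; lia.
have [j mj nj] := h (m - t.1); exists (j + t.1); first lia.
by apply/hconn_translate; rewrite !vertexBE /= addrK.
Qed.

(** The leftmost contact of a cluster with contacts arbitrarily far to the right
    is a distinguished site: of two such clusters, the one with leftmost contact
    further to the right would be confined by the other. *)
Lemma ae_right_unbounded (R : realType) (mu : probability (config edge) R)
  (reg : regular mu) k :
  \forall w \ae mu, forall n, right_unbounded k w n -> left_unbounded k w n.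
Proof.
pose D n w := right_unbounded k w n /\ forall m, m < n -> ~ hconn k w (n, k) (m, k).
have : \forall w \ae mu, forall n, ~ D n w.
  apply: (no_distinguished (regular_invariant reg)).
  - move=> n; apply: measurable_Pand; first exact: measurable_right_unbounded.
    apply: measurable_Pforall => m; apply: measurable_Pimply; first exact: measurable_Pconst.
    by apply: measurable_Pnot; exact: measurable_hconn.
  - move=> j n w; rewrite /D right_unbounded_translate /= subr0.
    split=> -[h1 h2]; split=> // m nm.
      by have := h2 (m + j); rewrite hconn_row_shift addrK; apply; lia.
    by rewrite hconn_row_shift; apply: h2; lia.
  - move=> w; suff lt n m : D n w -> D m w -> ~ (n < m).
      by move=> n m Dn Dm; case: (ltgtP n m) => // /lt; [move/(_ Dn Dm)|move/(_ Dm Dn)].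
    move=> [rn _] [rm mleft] nm; have [j mj nj] := rn m.
    apply: (trap_primal nj nm mj) (right_unbounded_hinf rm).
    by move/hconn_sym; exact: mleft.
apply: filterS => w noD n rn m; apply: contrapT => no.
have bound x : hconn k w (n, k) (x, k) -> m <= x.
  by move=> hx; rewrite leNgt; apply/negP => mx; apply: no; exists x.
have [|a na amin] := int_min bound; first by exists n; exact: hconn_refl.
apply: (noD a); split=> [b|b ba ab].
  by have [j bj nj] := rn b; exists j => //; exact: hconn_trans (hconn_sym na) nj.
by have := amin _ (hconn_trans na ab); lia.
Qed.

Lemma ae_left_unbounded (R : realType) (mu : probability (config edge) R)
  (reg : regular mu) k :
  \forall w \ae mu, forall n, left_unbounded k w n -> right_unbounded k w n.
Proof.
pose D n w := left_unbounded k w n /\ forall m, n < m -> ~ hconn k w (n, k) (m, k).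
have : \forall w \ae mu, forall n, ~ D n w.
  apply: (no_distinguished (regular_invariant reg)).
  - move=> n; apply: measurable_Pand; first exact: measurable_left_unbounded.
    apply: measurable_Pforall => m; apply: measurable_Pimply; first exact: measurable_Pconst.
    by apply: measurable_Pnot; exact: measurable_hconn.
  - move=> j n w; rewrite /D left_unbounded_translate /= subr0.
    split=> -[h1 h2]; split=> // m nm.
      by have := h2 (m + j); rewrite hconn_row_shift addrK; apply; lia.
    by rewrite hconn_row_shift; apply: h2; lia.
  - move=> w; suff lt n m : D n w -> D m w -> ~ (n < m).
      by move=> n m Dn Dm; case: (ltgtP n m) => // /lt; [move/(_ Dn Dm)|move/(_ Dm Dn)].
    move=> [ln nright] [lm _] nm; have [j jn mj] := lm n.
    apply: (trap_primal (hconn_sym mj) jn nm) (left_unbounded_hinf ln).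
    by move=> jn'; apply: (nright m nm); apply: hconn_sym; exact: hconn_trans mj jn'.
apply: filterS => w noD n rn m; apply: contrapT => no.
have bound x : hconn k w (n, k) (x, k) -> x <= m.
  by move=> hx; rewrite leNgt; apply/negP => mx; apply: no; exists x.
have [|a na amax] := int_max bound; first by exists n; exact: hconn_refl.
apply: (noD a); split=> [b|b ba ab].
  by have [j bj nj] := rn b; exists j => //; exact: hconn_trans (hconn_sym na) nj.
by have := amax _ (hconn_trans na ab); lia.
Qed.

Lemma spanning_translate t k w : spanning k (translate t w) <-> spanning (k - t.2) w.
Proof.
split=> -[n].
  by move=> /left_unbounded_translate h1 /right_unbounded_translate h2; exists (n - t.1).
move=> h1 h2; exists (n + t.1).
  by apply/left_unbounded_translate; rewrite addrK.
by apply/right_unbounded_translate; rewrite addrK.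
Qed.

Lemma measurable_spanning k : measurable [set w | spanning k w].
Proof.
rewrite (_ : [set w | _] = [set w | exists n, left_unbounded k w n /\ right_unbounded k w n]).
  apply: measurable_Pexists => n.
  apply: measurable_Pand; first exact: measurable_left_unbounded.
  exact: measurable_right_unbounded.
by apply/seteqP; split=> w [n]; [exists n|case=> ? ?; exists n].
Qed.

(** Any other cluster starting in the row would be confined between two contacts
    of the spanning cluster. *)
Lemma spanning_hconn k w n m :
  left_unbounded k w n -> right_unbounded k w n -> hinf k w (m, k) ->
  hconn k w (n, k) (m, k).
Proof.
move=> ln rn; have [a am na] := ln m; have [b mb nb] := rn m.
have ab := hconn_trans (hconn_sym na) nb.
move=> hm; apply: contrapT => nm; apply: (trap_primal ab am mb) hm.
by move=> am'; apply: nm; exact: hconn_trans na am'.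
Qed.

Lemma ae_bounded_contacts (R : realType) (mu : probability (config edge) R)
  (reg : regular mu) k :
  \forall w \ae mu, spanning k w \/ forall n, bounded_contacts k w n.
Proof.
apply: filterS2 (ae_right_unbounded reg k) (ae_left_unbounded reg k) => w rl lr.
have [|nsp] := pselect (spanning k w); [by left|right=> n].
have /existsNP[a na] : ~ right_unbounded k w n.
  by move=> rn; apply: nsp; exists n => //; exact: rl.
have /existsNP[b nb] : ~ left_unbounded k w n.
  by move=> ln; apply: nsp; exists n => //; exact: lr.
exists (`|a| + `|b|)%N => j nj.
have ja : j <= a by rewrite leNgt; apply/negP => aj; apply: na; exists j.
have bj : b <= j by rewrite leNgt; apply/negP => jb; apply: nb; exists j.
by lia.
Qed.

(** A cluster of the half-plane is the union of its contacts and of the clusters,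
    one row higher, of the points above its contacts.  A finite union of finite
    sets being finite, one of these clusters is infinite. *)
Lemma infinite_child k w n : hinf k w (n, k) -> bounded_contacts k w n ->
  exists2 j, hinf (k + 1) w (j, k + 1) & hconn k w (n, k) (j, k + 1).
Proof.
move=> hn [N bN]; apply: contrapT => nochild; apply: hn.
pose F (j : int) : set vertex := [set (j, k)] `|`
  (if `[< hconn k w (n, k) (j, k + 1) >]
   then [set v | hconn (k + 1) w (j, k + 1) v] else set0).
have fF j : finite_set (F j).
  rewrite finite_setU; split; first exact: finite_set1.
  case: asboolP => [nj|_]; last exact: finite_set0.
  by apply: contrapT => inf; apply: nochild; exists j.
apply: (@sub_finite_set _ _ (\bigcup_(j in [set j | (`|j| <= N)%N]) F j)); last first.
  by apply: bigcup_finite => [|j _]; [exact: finite_int_ball|exact: fF].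
move=> v nv.
suff : hconn k w (n, k) v /\ (v.2 = k \/
    exists j, [/\ hconn k w (n, k) (j, k), hconn k w (n, k) (j, k + 1) &
               hconn (k + 1) w (j, k + 1) v]).
  case=> {}nv [vk|[j [nj nj' jv]]].
    have vE : v = (v.1, k) by case: (v) vk => a b /= ->.
    by exists v.1; [apply: bN; rewrite -vE|left].
  by exists j; [exact: bN|right; rewrite asboolT].
apply: (hadj_ind (P := fun v => _ /\ _) _ nv); last first.
  by split; [exact: hconn_refl|left].
move=> e ke we; have E := hconn_edge ke we.
have nE : hconn k w (n, k) e.1 <-> hconn k w (n, k) (edge_ends e).2.
  by split=> h; apply: (hconn_trans h) => //; exact: hconn_sym.
have [k1|ke1] := leP (k + 1) e.1.2.
  have E' := hconn_edge k1 we.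
  have e1k : e.1.2 <> k by lia.
  have e2k : (edge_ends e).2.2 <> k by rewrite edge_endsE /=; lia.
  split=> -[/nE h [//|[j [h1 h2 h3]]]]; split=> //; right; exists j; split=> //.
    exact: hconn_trans h3 E'.
  exact: hconn_trans h3 (hconn_sym E').
have e1k : e.1.2 = k by lia.
split=> -[/nE h _]; split=> //; last by left.
move: nE h E; rewrite edge_endsE; case: e {ke ke1} we e1k => [[a b] []] /= we -> nE h E.
  right; exists a; rewrite addr0 in nE h E *; split=> //; last exact: hconn_refl.
  exact/nE.
by left; rewrite addr0.
Qed.

(** * Counting clusters: children and mass transport *)

Lemma touching_disconnected k w :
  (touching k w -> forall m, exists2 n, m < n & hinf k w (n, k)) ->
  (forall n, bounded_contacts k w n) -> touching k w ->
  exists n m, [/\ hinf k w (n, k), hinf k w (m, k) & ~ hconn k w (n, k) (m, k)].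
Proof.
move=> right bnd tk; have [n hn] := tk; have [N bN] := bnd n.
have [m Nm hm] := right tk N.
exists n, m; split=> // /bN; lia.
Qed.

(** Without a spanning cluster there are two infinite clusters touching row [k],
    with finitely many contacts each, hence with infinite children touching row
    [k + 1].  A spanning cluster of the half-plane above would contain both
    children and connect the two clusters. *)
Lemma spanning_zero_one (R : realType) (mu : probability (config edge) R)
  (reg : regular mu) :
  (\forall w \ae mu, forall k, touching k w) ->
  (\forall w \ae mu, forall k, spanning k w) \/
  (\forall w \ae mu, forall k, ~ spanning k w).
Proof.
move=> aet.
have [||k|h|h] := @zero_one R mu (fun k w => ~ spanning k w)
  (regular_invariant reg) (regular_ergodic reg).
- by move=> k; apply: measurable_Pnot; exact: measurable_spanning.
- by move=> v k w; rewrite spanning_translate.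
- apply: filterS3 aet (ae_touching_right reg k) (ae_bounded_contacts reg k).
  move=> w tk rk bk nsp [p lp rp].
  have {}bk : forall n, bounded_contacts k w n by case: bk.
  have [n [m [hn hm nm]]] := touching_disconnected rk bk (tk k).
  have [i hi ni] := infinite_child hn (bk n).
  have [j hj mj] := infinite_child hm (bk m).
  apply: nm; apply: (hconn_trans ni); apply: hconn_trans (hconn_sym mj).
  apply: (@hconn_mono (k + 1) k w w) => //; first by lia.
  exact: hconn_trans (hconn_sym (spanning_hconn lp rp hi)) (spanning_hconn lp rp hj).
- by right.
by left; apply: filterS h => w h k; exact: contrapT.
Qed.

(** Counting clusters by their leftmost contact turns their density into the
    probability of an event. *)
Definition leftmost k w n : Prop :=
  hinf k w (n, k) /\ forall m, m < n -> ~ hconn k w (n, k) (m, k).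

Lemma leftmost_unique k w n m :
  leftmost k w n -> leftmost k w m -> hconn k w (n, k) (m, k) -> n = m.
Proof.
move=> [_ ln] [_ lm] nm; case: (ltgtP n m) => // lt.
  by case: (lm _ lt); exact: hconn_sym.
by case: (ln _ lt).
Qed.

Lemma leftmost_exists k w n : hinf k w (n, k) -> bounded_contacts k w n ->
  exists2 m, leftmost k w m & hconn k w (n, k) (m, k).
Proof.
move=> hn [N bN].
have bound x : hconn k w (n, k) (x, k) -> - N%:Z <= x by move=> /bN; lia.
have [|m nm mmin] := int_min bound; first by exists n; exact: hconn_refl.
exists m => //; split; first exact: hinf_conn nm hn.
by move=> j jm mj; have := mmin _ (hconn_trans nm mj); lia.
Qed.

Lemma leftmost_translate t k w n :
  leftmost k (translate t w) n <-> leftmost (k - t.2) w (n - t.1).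
Proof.
rewrite /leftmost hinf_translate vertexBE /=; split=> -[h1 h2]; split=> // m nm.
  have := h2 (m + t.1); rewrite hconn_translate !vertexBE /= addrK; apply; lia.
by rewrite hconn_translate !vertexBE /=; apply: h2; lia.
Qed.

Lemma measurable_leftmost k n : measurable [set w | leftmost k w n].
Proof.
apply: measurable_Pand; first exact: measurable_hinf.
apply: measurable_Pforall => m; apply: measurable_Pimply; first exact: measurable_Pconst.
by apply: measurable_Pnot; exact: measurable_hconn.
Qed.

Definition child m n w : Prop :=
  leftmost 0 w m /\ leftmost 1 w n /\ hconn 0 w (m, 0) (n, 1).

(** A choice of one child that commutes with translations: the offset [n - m]
    comes first in a fixed enumeration of the integers. *)
Definition first_child m n w : Prop :=
  child m n w /\
  forall n', child m n' w -> (pickle (n - m)%R <= pickle (n' - m)%R)%N.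

Lemma child_translate j m n w :
  child m n (translate (j, 0) w) <-> child (m - j) (n - j) w.
Proof. by rewrite /child !leftmost_translate hconn_row_shift /= !subr0. Qed.

Lemma first_child_translate j m n w :
  first_child m n (translate (j, 0) w) <-> first_child (m - j) (n - j) w.
Proof.
have E a b : a - j - (b - j) = a - b by lia.
rewrite /first_child child_translate; split=> -[h1 h2]; split=> // n' c.
  have := h2 (n' + j); rewrite child_translate addrK => /(_ c).
  by rewrite E (_ : n' + j - m = n' - (m - j)) //; lia.
by move/child_translate: c => /h2; rewrite !E.
Qed.

Lemma measurable_child m n : measurable [set w | child m n w].
Proof.
apply: measurable_Pand; first exact: measurable_leftmost.
by apply: measurable_Pand; [exact: measurable_leftmost|exact: measurable_hconn].
Qed.

Lemma measurable_first_child m n : measurable [set w | first_child m n w].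
Proof.
apply: measurable_Pand; first exact: measurable_child.
apply: measurable_Pforall => n'; apply: measurable_Pimply; first exact: measurable_child.
exact: measurable_Pconst.
Qed.

Lemma first_child_exists m n w : child m n w -> exists n', first_child m n' w.
Proof.
move=> c.
have ex : exists i, `[< exists2 n', child m n' w & pickle (n' - m)%R = i >].
  by exists (pickle (n - m)%R); apply/asboolP; exists n.
case: (ex_minnP ex) => i /asboolP[n' c' <-] mini.
by exists n'; split=> // n2 c2; apply: mini; apply/asboolP; exists n2.
Qed.

Lemma first_child_inj m n n' w : first_child m n w -> first_child m n' w -> n = n'.
Proof.
move=> [c h] [c' h']; have E : pickle (n - m) = pickle (n' - m).
  by apply/eqP; rewrite eqn_leq h // h'.
by move/(pcan_inj pickleK)/addIr: E.
Qed.

Lemma first_child_parent_inj m m' n w :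
  first_child m n w -> first_child m' n w -> m = m'.
Proof.
move=> [[lm [_ mn]] _] [[lm' [_ mn']] _]; apply: (leftmost_unique lm lm').
exact: hconn_trans mn (hconn_sym mn').
Qed.

(** Every cluster of the lower half-plane has a first child, so by mass transport
    the leftmost contacts of first children have the density of the leftmost
    contacts in row 0.  By vertical stationarity this is the density of all
    leftmost contacts in row 1, so almost all of them belong to first children. *)
Lemma ae_first_child (R : realType) (mu : probability (config edge) R)
  (reg : regular mu) :
  (\forall w \ae mu, forall k n, bounded_contacts k w n) ->
  \forall w \ae mu, forall n, leftmost 1 w n -> exists m, first_child m n w.
Proof.
move=> bnd; have inv := regular_invariant reg.
pose A : set (config edge) := [set w | exists m, first_child m 0 w].
have mA : measurable A by apply: measurable_Pexists => m; exact: measurable_first_child.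
have mL k n := measurable_leftmost k n.
pose B : set (config edge) := [set w | exists n, first_child 0 n w].
have mB : measurable B by apply: measurable_Pexists => n; exact: measurable_first_child.
have BE : mu B = mu [set w | leftmost 0 w 0].
  have sub : B `<=` [set w | leftmost 0 w 0] by move=> w [n [[]]].
  have : mu ([set w | leftmost 0 w 0] `\` B) = 0%E.
    apply/measurable_ae0; first exact: measurableD.
    apply: filterS bnd => w bw [/= l0 nB]; apply: nB.
    have [j hj nj] := infinite_child l0.1 (bw 0 0).
    rewrite add0r in hj nj; have [n ln jn] := leftmost_exists hj (bw 1 j).
    apply: (@first_child_exists 0 n); split=> //; split=> //.
    by apply: hconn_trans nj _; exact: hconn_mono jn.
  move=> h; apply/esym; apply: etrans (measureDI mu (mL 0 0) mB) _.
  by rewrite [X in (X + _)%E](_ : _ = 0%E) // add0e; congr (mu _); apply: setIidr.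
have AE : mu A = mu [set w | leftmost 1 w 0].
  rewrite -(mass_transport (G := first_child) inv) ?BE.
  - rewrite -(inv (0, 1) [set w | leftmost 1 w 0]) //.
    congr (mu _); apply/funext => w /=; apply/propext.
    by rewrite leftmost_translate /= subrr subr0.
  - by move=> m n; exact: measurable_first_child.
  - by move=> j m n w; exact: first_child_translate.
  - by move=> w m n n'; exact: first_child_inj.
  - by move=> w m m' n; exact: first_child_parent_inj.
have A0 : mu (A `\` [set w | leftmost 1 w 0]) = 0%E.
  rewrite (_ : _ `\` _ = set0) ?measure0 //.
  by apply/seteqP; split=> w //= [[m [[_ []]]]].
have := null_diff_sym mA (mL 1 0) A0 AE.
set D := _ `\` _ => D0.
apply: ae_forall => n.
have mD : measurable D by exact: measurableD.
have : \forall w \ae mu, ~ (translate (- n, 0) @^-1` D) w.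
  apply/measurable_ae0; last by apply: etrans (inv _ D mD) _.
  by rewrite -[X in measurable X]setTI; exact: measurable_translate.
apply: filterS => w nD ln; apply: contrapT => no; apply: nD; split=> /=.
  by apply/leftmost_translate; rewrite /= opprK add0r subr0.
move=> [m /first_child_translate]; rewrite opprK add0r => fc.
by apply: no; exists (m + n).
Qed.

(** * Existence of a spanning cluster, uniqueness, and duality *)

Lemma modification_ball (N : nat) w w' :
  (forall e, (N < vnorm e.1)%N -> w' e = w e) -> finite_modification w w'.
Proof.
move=> far.
have /finite_seqP[s sE] :=
  finite_setX (finite_ball N) (@finite_finset _ [set: bool]).
exists s => e es; apply: far; rewrite ltnNge; apply/negP => eN.
by case/negP: es; suff : [set` s] e by []; rewrite -sE.
Qed.

Definition open_slab (N : nat) (w : config edge) : config edge :=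
  fun e => ((`|e.1.1| <= N)%N && (e.1.2 == 0)) || w e.

Lemma open_slab_modification N w : finite_modification w (open_slab N w).
Proof.
apply: (@modification_ball N) => -[[a b] d]; rewrite /open_slab /vnorm /= => far.
by have [/andP[aN /eqP b0]|//] := boolP ((`|a| <= N)%N && (b == 0)); lia.
Qed.

Lemma open_slab_hconn N w n m : (`|n| <= N)%N -> (`|m| <= N)%N ->
  hconn 0 (open_slab N w) (n, 1) (m, 1).
Proof.
have row (i : nat) : (i <= N.*2)%N ->
    hconn 0 (open_slab N w) (- N%:Z, 0) (i%:Z - N%:Z, 0).
  elim: i => [|i IH] iN; first by rewrite add0r; exact: hconn_refl.
  apply: hconn_trans (IH (ltnW iN)) _.
  have := @hconn_edge 0 (open_slab N w) ((i%:Z - N%:Z, 0), false).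
  rewrite edge_endsE /= addr0 (_ : i%:Z - N%:Z + 1%:Z = i.+1%:Z - N%:Z); last by lia.
  by apply=> //; rewrite /open_slab /= andbT; apply/orP; left; lia.
have base a : (`|a| <= N)%N -> hconn 0 (open_slab N w) (- N%:Z, 0) (a, 1).
  move=> aN; have := row `|(a + N%:Z)%R|%N; rewrite (_ : _ - N%:Z = a); last by lia.
  move=> h; apply: (hconn_trans (h _)); first by lia.
  have := @hconn_edge 0 (open_slab N w) ((a, 0), true).
  by rewrite edge_endsE /= addr0 add0r; apply=> //; rewrite /open_slab /= aN.
by move=> nN mN; apply: hconn_trans (hconn_sym (base n nN)) (base m mN).
Qed.

(** Otherwise two infinite clusters touch row 1.  Opening the edges of a long
    slab below row 1 connects them to each other in the lower half-plane without
    changing the clusters of the half-plane above, so they get a common parent,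
    of which both would be the first child. *)
Lemma ae_spanning (R : realType) (mu : probability (config edge) R)
  (reg : regular mu) :
  (\forall w \ae mu, forall k, touching k w) ->
  \forall w \ae mu, forall k, spanning k w.
Proof.
move=> aet; case: (spanning_zero_one reg aet) => // nsp.
have bnd : \forall w \ae mu, forall k n, bounded_contacts k w n.
  apply: filterS2 nsp (ae_forall (ae_bounded_contacts reg)) => w nsp bw k.
  by case: (bw k) => // /(nsp k).
have fc := ae_modification (regular_tolerant reg) (ae_first_child reg bnd).
have tb : \forall w \ae mu, (forall k, touching k w) /\
    (forall k n, bounded_contacts k w n).
  by apply: filterS2 aet bnd => w.
have [w [[tk bw] [right {}fc]]] : exists w,
    ((forall k, touching k w) /\ (forall k n, bounded_contacts k w n)) /\
    ((touching 1 w -> forall m, exists2 n, m < n & hinf 1 w (n, 1)) /\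
    forall w', finite_modification w w' ->
      forall n, leftmost 1 w' n -> exists m, first_child m n w').
  apply: (ae_exists (mu := mu)).
  by apply: filterS3 tb (ae_touching_right reg 1) fc => w.
have [n [m [hn hm nm]]] := touching_disconnected right (bw 1) (tk 1).
have [p lp np] := leftmost_exists hn (bw 1 n).
have [q lq mq] := leftmost_exists hm (bw 1 m).
pose N := (`|p| + `|q|)%N.
(* the slab lies below row 1 *)
have up j : leftmost 1 w j -> leftmost 1 (open_slab N w) j.
  move=> [h1 h2]; split.
    by apply: hinf_mono h1 => // e _; rewrite /open_slab orbC => ->.
  move=> i ij c; apply: (h2 i ij); apply: hconn_mono c => // e e1.
  by rewrite /open_slab => /orP[/andP[_ /eqP e0]|//]; rewrite e0 in e1.
have [i pi] := fc _ (open_slab_modification N w) p (up p lp).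
have [j qj] := fc _ (open_slab_modification N w) q (up q lq).
have pq : hconn 0 (open_slab N w) (p, 1) (q, 1) by apply: open_slab_hconn; lia.
have ij : i = j.
  case: (pi) (qj) => -[li [_ ip]] _ [[lj [_ jq]] _]; apply: (leftmost_unique li lj).
  exact: hconn_trans (hconn_trans ip pq) (hconn_sym jq).
rewrite -ij in qj; have E := first_child_inj pi qj.
by case: nm; apply: hconn_trans np _; rewrite E; exact: hconn_sym.
Qed.

(** Seen from the height of its lowest vertex, a cluster is a cluster of a smaller
    half-plane, and it touches the bottom row there. *)
Lemma lowest_vertex k w u : hinf k w u ->
  exists v, [/\ hconn k w u v, hinf v.2 w v & forall z, hconn k w u z -> v.2 <= z.2].
Proof.
move=> hu; have ku := hinf_ge hu.
have [y|| y [v uv <-] ymin] := @int_min (fun y => exists2 v, hconn k w u v & v.2 = y) k.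
- by move=> [v uv <-]; exact: hconn_ge uv ku.
- by exists u.2, u => //; exact: hconn_refl.
have low z : hconn k w u z -> v.2 <= z.2 by move=> uz; apply: ymin; exists z.
exists v; split=> //; have := hinf_conn uv hu.
apply: contra_not; apply: sub_finite_set => z /= vz.
suff [] : hconn k w v z /\ hconn v.2 w v z by [].
apply: (hadj_ind (P := fun z => _ /\ hconn v.2 w v z) _ vz); last first.
  by split; exact: hconn_refl.
move=> e ke we; have E := hconn_edge ke we.
have E' : hconn k w v e.1 -> hconn v.2 w e.1 (edge_ends e).2.
  by move=> ve; apply: hconn_edge => //; apply: low; exact: hconn_trans uv ve.
split=> -[h hv].
  by split; [exact: hconn_trans h E|exact: hconn_trans hv (E' h)].
have h' := hconn_trans h (hconn_sym E).
by split=> //; exact: hconn_trans hv (hconn_sym (E' h')).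
Qed.

Lemma touching_of_infinite w u : hinf 0 w u -> exists k, touching k w.
Proof.
move=> /lowest_vertex[[x y] [_ h _]]; exists y; by exists x.
Qed.

(** Closing the horizontal edges on both sides of the opened segment keeps it
    away from all clusters but the one at its top. *)
Definition connect_down x (h : int) (w : config edge) : config edge :=
  fun e => if 0 <= e.1.2 < h then
    if e.2 then (e.1.1 == x) || w e
    else (e.1.1 != x) && (e.1.1 + 1 != x) && w e
  else w e.

Lemma connect_down_modification x h w : finite_modification w (connect_down x h w).
Proof.
apply: (@modification_ball (`|x| + `|h| + 1)%N) => -[[a b] d].
rewrite /connect_down /vnorm /= => far; case: ifP => // bh.
have -> : (a == x) = false by lia.
have -> : (a + 1 == x) = false by lia.
by case: d.
Qed.

(** A spanning cluster contains every infinite cluster touching row 0.  For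
    another infinite cluster, which then does not touch row 0, open an isolated
    vertical segment from its lowest vertex down to row 0.  The cluster thus
    obtained is infinite and touches row 0 once, so that it is neither the
    spanning cluster of the modified configuration nor disjoint from it. *)
Lemma infinite_clusters_connected w :
  (forall w', finite_modification w w' -> spanning 0 w') ->
  forall u v, hinf 0 w u -> hinf 0 w v -> hconn 0 w u v.
Proof.
move=> spw; have [n ln rn] : spanning 0 w by apply: spw; exists [::].
suff main u : hinf 0 w u -> hconn 0 w (n, 0) u.
  by move=> u v /main nu /main; apply: hconn_trans; exact: hconn_sym.
move=> hu; apply: contrapT => nu.
have notouch j : ~ hconn 0 w u (j, 0).
  move=> uj; apply: nu; apply: hconn_trans (hconn_sym uj).
  exact: spanning_hconn ln rn (hinf_conn uj hu).
have [[x h] [/= ub _ low]] := lowest_vertex hu.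
have h0 : 0 < h.
  have h0 : 0 <= h := hconn_ge ub (hinf_ge hu).
  rewrite lt_neqAle h0 andbT; apply/eqP => E.
  by rewrite -E in ub; exact: notouch ub.
set w' := connect_down x h w.
(* edges based in the cluster of u are at height h or more, hence unmodified *)
have keep (e : edge) : 0 <= e.1.2 -> w e -> hconn 0 w u e.1 -> w' e.
  move=> e0 we /low /= he; rewrite /w' /connect_down ifF //; lia.
have inB v : hconn 0 w u v -> hconn 0 w' u v.
  move=> uv; suff [] : hconn 0 w u v /\ hconn 0 w' u v by [].
  apply: (hadj_ind (P := fun v => _ /\ hconn 0 w' u v) _ uv); last first.
    by split; exact: hconn_refl.
  move=> e ke we; have E := hconn_edge ke we.
  have E' : hconn 0 w u e.1 -> hconn 0 w' e.1 (edge_ends e).2.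
    by move=> ve; apply: hconn_edge => //; exact: keep.
  split=> -[hw hw'].
    by split; [exact: hconn_trans hw E|exact: hconn_trans hw' (E' hw)].
  have hw1 := hconn_trans hw (hconn_sym E).
  by split=> //; exact: hconn_trans hw' (hconn_sym (E' hw1)).
have column (i : nat) : i%:Z <= h -> hconn 0 w' (x, 0) (x, i%:Z).
  elim: i => [|i IH] ih; first exact: hconn_refl.
  apply: hconn_trans (IH _) _; first by lia.
  have := @hconn_edge 0 w' ((x, i%:Z), true).
  rewrite edge_endsE /= addr0 (_ : i%:Z + 1%:Z = i.+1%:Z); last by lia.
  by apply=> //; rewrite /w' /connect_down /= eqxx ifT //; lia.
have ux : hconn 0 w' u (x, 0).
  apply: hconn_trans (inB _ ub) (hconn_sym _).
  by have := column `|h|%N; rewrite (_ : `|h|%N%:Z = h); [apply; lia|lia].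
have hx : hinf 0 w' (x, 0).
  apply: (hinf_conn ux); have := hu; apply: contra_not.
  by apply: sub_finite_set => v; exact: inB.
(* the segment meets nothing but the cluster of u, at its top *)
have inside v : hconn 0 w' u v -> hconn 0 w u v \/ v.1 = x /\ 0 <= v.2 < h.
  move=> uv; pose P v := hconn 0 w u v \/ v.1 = x /\ 0 <= v.2 < h.
  apply: (hadj_ind (P := P) _ uv); last first.
    by left; exact: hconn_refl.
  move=> e ke; rewrite /P /w' /connect_down => we.
  have E : w e -> hconn 0 w u e.1 <-> hconn 0 w u (edge_ends e).2.
    move=> we'; have E := hconn_edge ke we'.
    by split=> c; apply: (hconn_trans c) => //; exact: hconn_sym.
  move: we E; rewrite edge_endsE; case: e ke => [[a b] []] /= b0.
    rewrite addr0; case: ifP => bh /=; last first.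
      by move=> /[swap] /[apply] ->; split=> -[]; auto; lia.
    case: (eqVneq a x) => [-> _ _|ax /= /[swap] /[apply] ->]; last first.
      by split=> -[?|[ax' _]]; [left|rewrite ax' eqxx in ax|left|rewrite ax' eqxx in ax].
    split=> _; last by right.
    have [bh'|hb] := ltP (b + 1) h; first by right; split=> //; lia.
    by left; rewrite (_ : b + 1 = h) //; lia.
  rewrite addr0; case: ifP => bh; last first.
    by move=> /[swap] /[apply] ->; split=> -[]; auto; lia.
  move=> /andP[/andP[/eqP ax /eqP ax1] we] /(_ we) ->.
  by split=> -[?|[]]; auto.
have [m lm rm] := spw _ (connect_down_modification x h w).
have [j xj mj] := rm x.
have mx := spanning_hconn lm rm hx.
have uj : hconn 0 w' u (j, 0).
  by apply: hconn_trans ux _; exact: hconn_trans (hconn_sym mx) mj.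
by case: (inside _ uj) => [/notouch //|/= [E _]]; move: xj; rewrite E ltxx.
Qed.

(** The dual edge based at [(n, -1)] crosses the boundary edge based at [(n, 0)],
    so that the latter is closed and the spanning cluster confines the dual
    cluster. *)
Lemma spanning_not_dual w : spanning 0 w ->
  (exists2 n, hinf 0 (dual_config w) (n, 0) & dual_config w ((n, -1), true)) -> False.
Proof.
move=> [p lp rp] [n hn dn]; have [a an pa] := lp n; have [b nb pb] := rp n.
apply: (trap_dual (hconn_trans (hconn_sym pa) pb) (ltW an) nb) hn.
by move: dn; rewrite /dual_config /primal_edge /= vertexDE /= addr0 addNr.
Qed.

Lemma dual_translate v w : dual_config (translate v w) = translate v (dual_config w).
Proof.
by apply: funext => -[z []]; rewrite /dual_config /translate /primal_edge /= addrAC.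
Qed.

Lemma measurable_dual (A : set (config edge)) :
  measurable A -> measurable (dual_config @^-1` A).
Proof.
move=> mA; rewrite -[X in measurable X]setTI.
exact: (@measurable_reindex _ _ primal_edge negb).
Qed.

Lemma regular_dual (R : realType) (mu : probability (config edge) R) :
  regular mu -> regular (dual_measure mu).
Proof.
move=> [inv erg tol]; split.
- move=> v A mA; have := inv v _ (measurable_dual mA); congr (_ = _).
  by congr (mu _); apply: funext => w; rewrite /preimage /= dual_translate.
- move=> A mA iA; apply: (erg _ (measurable_dual mA)) => v.
  by rewrite -[in RHS](iA v); apply: funext => w; rewrite /preimage /= dual_translate.
move=> e b A mA iA A0; apply: (tol (primal_edge e) (~~ b) _ (measurable_dual mA)).
  move=> w w' ww' /=; apply: iA => f fe; rewrite /dual_config ww' //.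
  by apply: contra_neq fe; exact: (can_inj primal_edgeK).
apply: etrans A0; congr (mu _); apply/seteqP; rewrite /dual_config.
split=> w /= [Aw wb]; split=> //; first by change (~~ w (primal_edge e) = b); rewrite wb negbK.
move: wb; change (~~ w (primal_edge e) = b -> w (primal_edge e) = ~~ b).
by move=> <-; rewrite negbK.
Qed.

Lemma ae_dichotomy (R : realType) (mu : probability (config edge) R)
  (reg : regular mu) :
  (\forall w \ae mu, [/\ forall u v, hinf 0 w u -> hinf 0 w v -> hconn 0 w u v,
     spanning 0 w & exists2 n, hinf 0 w (n, 0) & w ((n, -1), true)]) \/
  (\forall w \ae mu, forall u, ~ hinf 0 w u).
Proof.
case: (touching_zero_one reg) => [tk|ntk]; [left|right]; last first.
  by apply: filterS ntk => w ntk u /touching_of_infinite[k]; exact: ntk.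
have sp : \forall w \ae mu, spanning 0 w.
  by apply: filterS (ae_spanning reg tk) => w; apply.
apply: filterS3 tk (ae_open_below reg (-1)) (ae_modification (regular_tolerant reg) sp).
move=> w tk ob fd; split; first exact: infinite_clusters_connected.
  by apply: fd; exists [::].
by rewrite addNr in ob; exact: ob.
Qed.

Definition hp_site : Type := {v : vertex | hp_vertex v}.

Lemma hp_edgeE (e : edge) : hp_edge e = (0 <= e.1.2).
Proof.
by rewrite /hp_edge edge_endsE /hp_vertex /=; case: e => [[a b] []] /=; lia.
Qed.

Lemma hp_open_cluster w (u v : hp_site) :
  open_cluster hp_edge_ends (restrict_config hp_edge w) u v <->
  hconn 0 w (val u) (val v).
Proof.
split=> [uv|uv].
  elim: uv => [x y [e [we E]]|x|x y z _ + _]; last exact: hconn_trans.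
    apply: rt_step; exists (val e); split=> //; first by rewrite -hp_edgeE (valP e).
    rewrite /hp_edge_ends in E; rewrite [edge_ends _]surjective_pairing.
    by case: E => -[<- <-]; [left|right].
  exact: hconn_refl.
suff [h] : exists h : hp_vertex (val v),
    open_cluster hp_edge_ends (restrict_config hp_edge w) u (exist _ (val v) h).
  by rewrite (_ : exist _ _ _ = v) //; exact: val_inj.
pose P z := exists h : hp_vertex z,
  open_cluster hp_edge_ends (restrict_config hp_edge w) u (exist _ z h).
apply: (hadj_ind (P := P) _ uv); last first.
  exists (valP u); rewrite (_ : exist _ _ _ = u); last exact: val_inj.
  exact: rt_refl.
move=> e ke we; have he : hp_edge e by rewrite hp_edgeE.
have [h1 h2] := andP he.
split=> -[h c]; [exists h2|exists h1]; apply: (rt_trans _ _ _ _ _ c); apply: rt_step;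
  exists (exist _ e he); split=> //; rewrite /hp_edge_ends; [left|right];
  by congr (_, _); apply: val_inj.
Qed.

Lemma hp_infinite_cluster w (u : hp_site) :
  infinite_set (open_cluster hp_edge_ends (restrict_config hp_edge w) u) <->
  hinf 0 w (val u).
Proof.
split; apply: contra_not => fin.
  have := finite_preimage (in2W (@val_inj _ _ hp_site)) fin.
  by apply: sub_finite_set => z /hp_open_cluster.
have := finite_image val fin; apply: sub_finite_set => z /= uz.
have h : hp_vertex z by exact: hconn_ge uz (valP u).
by exists (exist _ z h) => //; apply/hp_open_cluster.
Qed.

Lemma unique_infinite_clusterP w :
  unique_infinite_cluster hp_edge_ends (restrict_config hp_edge w) <->
  (exists u, hinf 0 w u) /\ forall u v, hinf 0 w u -> hinf 0 w v -> hconn 0 w u v.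
Proof.
split=> [[C [[[u ->] iC] uniq]]|[[u hu] conn]].
  split; first by exists (val u); apply/hp_infinite_cluster.
  move=> a b ha hb; pose a' : hp_site := exist _ a (hinf_ge ha).
  pose b' : hp_site := exist _ b (hinf_ge hb).
  have clE (c : hp_site) : hinf 0 w (val c) ->
      open_cluster hp_edge_ends (restrict_config hp_edge w) u =
      open_cluster hp_edge_ends (restrict_config hp_edge w) c.
    by move=> hc; apply: uniq; split; [exists c|apply/hp_infinite_cluster].
  apply/(hp_open_cluster w a' b'); rewrite -/(open_cluster _ _ a' b').
  rewrite -(clE a' ha) (clE b' hb); exact: rt_refl.
pose u' : hp_site := exist _ u (hinf_ge hu).
exists (open_cluster hp_edge_ends (restrict_config hp_edge w) u'); split.
  by split; [exists u'|apply/hp_infinite_cluster].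
move=> C [[v ->] iC]; have hv : hinf 0 w (val v) by apply/hp_infinite_cluster.
have uv := conn _ _ hu hv.
apply/seteqP; split=> z /hp_open_cluster h; apply/hp_open_cluster.
  exact: hconn_trans (hconn_sym uv) h.
exact: hconn_trans uv h.
Qed.

Lemma no_infinite_clusterP w :
  no_infinite_cluster hp_edge_ends (restrict_config hp_edge w) <->
  forall u, ~ hinf 0 w u.
Proof.
split=> [no u hu|no [C [[u ->]]]]; last by move/hp_infinite_cluster/no.
pose u' : hp_site := exist _ u (hinf_ge hu); apply: no.
exists (open_cluster hp_edge_ends (restrict_config hp_edge w) u').
by split; [exists u'|apply/hp_infinite_cluster].
Qed.

(** Configurations of the half-plane extend measurably to the whole lattice, which
    turns measurability of [Q] into measurability of [P]. *)
Lemma ae_hp_marginal (R : realType) (mu : probability (config edge) R)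
  (P : config {e : edge | hp_edge e} -> Prop) (Q : config edge -> Prop) :
  measurable [set w | Q w] -> (forall w, P (restrict_config hp_edge w) <-> Q w) ->
  (\forall w \ae mu, Q w) -> \forall w \ae hp_marginal mu, P w.
Proof.
move=> mQ PQ aeQ.
pose e0 : {e : edge | hp_edge e} := exist _ ((0, 0), false) isT.
pose ext (w : config {e : edge | hp_edge e}) : config edge :=
  fun e => w (insubd e0 e).
have extK h : restrict_config hp_edge (ext h) = h.
  by apply: funext => e; rewrite /restrict_config /ext valKd.
have mNQ : measurable (~` [set w | Q w]) by exact: measurableC.
have NQ0 : mu (~` [set w | Q w]) = 0%E.
  by apply/(measurable_ae0 mu mNQ); apply: filterS aeQ => w Qw; apply.
exists (ext @^-1` (~` [set w | Q w])); split.
- rewrite -[X in measurable X]setTI.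
  exact: (@measurable_reindex _ _ (fun e => insubd e0 e) id).
- apply: etrans NQ0; congr (mu _); apply/funext => w; apply/propext.
  have E : Q (ext (restrict_config hp_edge w)) <-> Q w by rewrite -!PQ extK.
  by split; apply: contra_not => /E.
by move=> w /= nP Qw; apply: nP; rewrite -(extK w); apply/PQ.
Qed.

End HalfPlanes.

Theorem theorem1p1 (R : realType) (mu : probability (config edge) R)
  (mu_inv : translation_invariant mu) (mu_erg : ergodic mu)
  (mu_fe : finite_energy mu) :
  [\/ {ae hp_marginal mu,
         forall w, unique_infinite_cluster hp_edge_ends w} /\
      {ae hp_marginal (dual_measure mu),
         forall w, no_infinite_cluster hp_edge_ends w},
      {ae hp_marginal (dual_measure mu),
         forall w, unique_infinite_cluster hp_edge_ends w} /\
      {ae hp_marginal mu,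
         forall w, no_infinite_cluster hp_edge_ends w} |
      {ae hp_marginal mu,
         forall w, no_infinite_cluster hp_edge_ends w} /\
      {ae hp_marginal (dual_measure mu),
         forall w, no_infinite_cluster hp_edge_ends w}].
Proof.
have reg : regular mu by split=> //; exact: finite_energy_tolerant.
have reg' := regular_dual reg.
have uniq (nu : probability (config edge) R) :
    (\forall w \ae nu, [/\ forall u v, hinf 0 w u -> hinf 0 w v -> hconn 0 w u v,
      spanning 0 w & exists2 n, hinf 0 w (n, 0) & w ((n, -1), true)]) ->
    {ae hp_marginal nu, forall w, unique_infinite_cluster hp_edge_ends w}.
  move=> aeU; apply: ae_hp_marginal unique_infinite_clusterP _.
    apply: measurable_Pand.
      by apply: measurable_Pexists => u; exact: measurable_hinf.
    apply: measurable_Pforall => u; apply: measurable_Pforall => v.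
    apply: measurable_Pimply; first exact: measurable_hinf.
    by apply: measurable_Pimply; [exact: measurable_hinf|exact: measurable_hconn].
  by apply: filterS aeU => w [conn _ [n hn _]]; split=> //; exists (n, 0).
have none (nu : probability (config edge) R) :
    (\forall w \ae nu, forall u, ~ hinf 0 w u) ->
    {ae hp_marginal nu, forall w, no_infinite_cluster hp_edge_ends w}.
  move=> aeN; apply: ae_hp_marginal no_infinite_clusterP aeN.
  apply: measurable_Pforall => u; apply: measurable_Pnot; exact: measurable_hinf.
case: (ae_dichotomy reg) (ae_dichotomy reg') => [U|N] [U'|N'].
- exfalso; have [N [mN N0 bN]] := U'.
  have aeN : \forall w \ae mu, ~ (dual_config @^-1` N) w.
    by apply/measurable_ae0; [exact: measurable_dual|exact: N0].
  have [w [sp [n hn dn]]] : exists w, spanning 0 w /\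
      exists2 n, hinf 0 (dual_config w) (n, 0) & dual_config w ((n, -1), true).
    apply: (ae_exists (mu := mu)); apply: filterS2 U aeN => w [_ sp _] Nw.
    split=> //; have [] // : [/\ forall u v, hinf 0 (dual_config w) u ->
        hinf 0 (dual_config w) v -> hconn 0 (dual_config w) u v,
        spanning 0 (dual_config w) & exists2 n, hinf 0 (dual_config w) (n, 0) &
        dual_config w ((n, -1), true)].
    by apply: contrapT => h; apply: Nw; exact: bN.
  by apply: spanning_not_dual sp _; exists n.
- by apply: Or31; split; [exact: uniq|exact: none].
- by apply: Or32; split; [exact: uniq|exact: none].
- by apply: Or33; split; exact: none.
Qed.
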